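(* Let $n\ge1$ and let $\mathbf X$ be the $n$-dimensional random vector $$\mathbf X=\boldsymbol\mu+V\boldsymbol\gamma+\sqrt V\,\mathbf\Sigma^{\frac12}\mathbf Z,$$ where $\boldsymbol\mu,\boldsymbol\gamma\in\mathbb R^n$, $\mathbf\Sigma\in\mathbb R^{n\times n}$ is positive definite with square root $\mathbf\Sigma^{\frac12}$, $\mathbf Z\sim ELL_n(\mathbf 0,\mathbf I_n,g)$, $V$ is a nonnegative scalar random variable with distribution $F$, and $\mathbf Z$ and $V$ are independent. Then the characteristic function $\psi_{\mathbf X}(\mathbf t)=E(e^{i\mathbf t'\mathbf X})$ of $\mathbf X$ is $$\psi_{\mathbf X}(\mathbf t)=e^{i\mathbf t'\boldsymbol\mu}\int_0^\infty e^{iv\mathbf t'\boldsymbol\gamma}\,\phi(v\,\mathbf t'\mathbf\Sigma\mathbf t)\,dF(v),\qquad \mathbf t\in\mathbb R^n,$$ where $\phi:[0,\infty)\to\mathbb R$ is defined by $$\phi(u^2)=c_n(2\pi)^{\frac n2}\,u^{-\frac{n-2}{2}}\int_0^\infty r^{\frac n2}J_{\frac{n-2}{2}}(ru)\,g(r^2)\,dr,\qquad u\ge0,$$ the value at $u=0$ being understood as the limit of the right-hand side as $u\to0^+$, and $$c_n=\frac{\Gamma(\frac n2)}{\pi^{n/2}}\left(\int_0^\infty z^{\frac n2-1}g(z)\,dz\right)^{-1}.$$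
   Context: A prime denotes transpose; $\mathbf 0$ is the zero vector in $\mathbb R^n$ and $\mathbf I_n$ the $n\times n$ identity matrix. $\mathbf\Sigma^{\frac12}$ is the (symmetric positive definite) square root of $\mathbf\Sigma$. $\mathbf Z\sim ELL_n(\mathbf 0,\mathbf I_n,g)$ means that $\mathbf Z$ is a random vector in $\mathbb R^n$ with probability density $f(\mathbf z)=c_n\,g(\mathbf z'\mathbf z)$, $\mathbf z\in\mathbb R^n$, where the density generator $g:[0,\infty)\to[0,\infty)$ is a (measurable) function with $0<\int_0^\infty z^{\frac n2-1}g(z)\,dz<\infty$ and $c_n=\frac{\Gamma(n/2)}{\pi^{n/2}}\big(\int_0^\infty z^{\frac n2-1}g(z)\,dz\big)^{-1}$. $J_\nu$ is the Bessel function of the first kind of order $\nu$: $J_\nu(x)=\sum_{k=0}^\infty(-1)^k\frac{1}{k!\,\Gamma(\nu+k+1)}\left(\frac x2\right)^{\nu+2k}$. The integral with respect to $F$ is over $[0,\infty)$, including any atom of $F$ at $0$. *)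

(* Defs.v *)
From HB Require Import structures.
From mathcomp Require Import all_boot all_order all_algebra.
From mathcomp Require Import all_classical all_reals all_analysis.
From mathcomp.real_closed Require Import complex.

Set Implicit Arguments.
Unset Strict Implicit.
Unset Printing Implicit Defensive.

Import Order.TTheory GRing.Theory Num.Theory.
Import numFieldNormedType.Exports.
Local Open Scope classical_set_scope.
Local Open Scope ring_scope.

(* As a measurable space, R^n is [n.-tuple R] (product of the Borel
   sigma-algebras); vectors of linear algebra are columns, reached by [colv]. *)
Definition colv (R : realType) (n : nat) (z : n.-tuple R) : 'cV[R]_n :=
  \col_i tnth z i.

Definition dotv (R : realType) (n : nat) (u v : 'cV[R]_n) : R :=
  (u^T *m v) 0 0.

Definition quadf (R : realType) (n : nat) (A : 'M[R]_n) (t : 'cV[R]_n) : R :=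
  (t^T *m A *m t) 0 0.

Definition posdefmx (R : realType) (n : nat) (A : 'M[R]_n) : Prop :=
  A^T = A /\ forall t : 'cV[R]_n, t != 0 -> 0 < quadf A t.

Definition is_sqrtmx (R : realType) (n : nat) (A S : 'M[R]_n) : Prop :=
  posdefmx S /\ S *m S = A.

Section lebesgue_tuple.
Variable R : realType.
Local Open Scope ereal_scope.

Definition cons_tup (n : nat) (p : R * n.-tuple R) : n.+1.-tuple R :=
  [tuple of p.1 :: p.2].

Lemma measurable_cons_tup n :
  measurable_fun [set: R * n.-tuple R] (@cons_tup n).
Proof. exact: measurable_cons. Qed.

Section step.
Variables (n : nat) (m : {sigma_finite_measure set (n.-tuple R) -> \bar R}).

Definition lebesgue_step : set (n.+1.-tuple R) -> \bar R :=
  pushforward (@lebesgue_measure R \x m) (@cons_tup n).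

HB.instance Definition _ := Measure.copy lebesgue_step
  (measure_function_pushforward__canonical__measure_function_Measure
    (@lebesgue_measure R \x m) (@measurable_cons_tup n)).

Let lebesgue_step_sigma_finite : sigma_finite setT lebesgue_step.
Proof.
have /sigma_finiteP[F [TF ndF Foo]] := sigma_finiteT (@lebesgue_measure R).
have /sigma_finiteP[G [TG ndG Goo]] := sigma_finiteT m.
pose hd (z : n.+1.-tuple R) := thead z.
pose tl (z : n.+1.-tuple R) := [tuple of behead z].
exists (fun k => hd @^-1` F k `&` tl @^-1` G k).
  apply/esym; rewrite -subTset => z _.
  have [i _ Fi] : (\bigcup_k F k) (hd z) by rewrite -TF.
  have [j _ Gj] : (\bigcup_k G k) (tl z) by rewrite -TG.
  exists (maxn i j) => //; split => /=.
    by move: Fi; exact/subsetPset/ndF/leq_maxl.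
  by move: Gj; exact/subsetPset/ndG/leq_maxr.
move=> k; have [mF Fk] := Foo k; have [mG Gk] := Goo k; split.
  apply: measurableI.
    by rewrite -[X in measurable X]setTI; exact: measurable_tnth.
  by rewrite -[X in measurable X]setTI; exact: measurable_behead.
rewrite /lebesgue_step /pushforward (_ : _ @^-1` _ = F k `*` G k); last first.
  apply/seteqP; split=> -[x t] /= [Fx Gt]; split => //.
    by move: Gt; congr (G k _); apply: val_inj.
  by move: Gt; congr (G k _); apply: val_inj.
by rewrite product_measure1E// lte_mul_pinfty// ge0_fin_numE.
Qed.

HB.instance Definition _ := Measure_isSigmaFinite.Build _ _ _
  lebesgue_step lebesgue_step_sigma_finite.

End step.

Fixpoint lebesgue_tuple (n : nat) :
    {sigma_finite_measure set (n.-tuple R) -> \bar R} :=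
  match n with
  | 0%N => \d_ [tuple]
  | m.+1 => lebesgue_step (lebesgue_tuple m)
  end.

Lemma lebesgue_tuple_box (n : nat) (A : 'I_n -> set R) :
  (forall i, measurable (A i)) ->
  lebesgue_tuple n [set z | forall i, A i (tnth z i)] =
  \prod_(i < n) @lebesgue_measure R (A i).
Proof.
elim: n A => [|n IH] A mA /=.
  by rewrite big_ord0 diracE mem_set// => -[].
rewrite big_ord_recl -IH// /lebesgue_step /pushforward.
rewrite (_ : _ @^-1` _ = A ord0 `*`
  [set z | forall i, A (lift ord0 i) (tnth z i)]); last first.
  apply/seteqP; split=> -[x t] /=.
    move=> H; split; first exact: (H ord0).
    by move=> i; have := H (lift ord0 i); rewrite tnthS.
  case=> Ax At i; case: (unliftP ord0 i) => [j|] ->.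
    by rewrite tnthS; exact: At.
  exact: Ax.
rewrite product_measure1E//; first exact: mA.
have -> : [set z | forall i, A (lift ord0 i) (tnth z i)] =
    \bigcap_(i in [set: 'I_n]) ((@tnth n R)^~ i @^-1` A (lift ord0 i)).
  by apply/seteqP; split=> z /= H i; [move=> _|]; exact: H.
apply: fin_bigcap_measurable => // i _.
by rewrite -[X in measurable X]setTI; exact: measurable_tnth.
Qed.

End lebesgue_tuple.

(* Euler's integral; meaningful for 0 < x, the only range used here. *)
Definition Gamma (R : realType) (x : R) : R :=
  \int[lebesgue_measure]_(t in `]0, +oo[) (t `^ (x - 1) * expR (- t)).

(* For -1 < nu and 0 <= x, so that Gamma is only taken at positive reals. *)
Definition besselJ (R : realType) (nu x : R) : R :=
  limn (series (fun k : nat =>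
    (-1) ^+ k / (k`!%:R * Gamma (nu + k%:R + 1)) *
    (x / 2) `^ (nu + 2 * k%:R))).

Local Open Scope complex_scope.

Definition cexpi (R : realType) (x : R) : R[i] := cos x +i* sin x.

Definition Cintegral (d : measure_display) (T : measurableType d)
    (R : realType) (mu : {measure set T -> \bar R}) (D : set T)
    (f : T -> R[i]) : R[i] :=
  (\int[mu]_(x in D) complex.Re (f x)) +i* (\int[mu]_(x in D) complex.Im (f x)).

Definition charfun (d : measure_display) (T : measurableType d)
    (R : realType) (P : probability T R) (n : nat) (X : T -> 'cV[R]_n)
    (t : 'cV[R]_n) : R[i] :=
  Cintegral P setT (fun w => cexpi (dotv t (X w))).

Definition independent_rv (d d1 d2 : measure_display) (T : measurableType d)
    (T1 : measurableType d1) (T2 : measurableType d2) (R : realType)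
    (P : probability T R) (X : {RV P >-> T1}) (Y : {RV P >-> T2}) : Prop :=
  forall (A : set T1) (B : set T2), measurable A -> measurable B ->
    P (X @^-1` A `&` Y @^-1` B) = (P (X @^-1` A) * P (Y @^-1` B))%E.

Definition is_density_generator (R : realType) (n : nat) (g : R -> R) : Prop :=
  [/\ measurable_fun (`[0, +oo[ : set R) g,
      forall z : R, 0 <= z -> 0 <= g z &
      (0 < \int[lebesgue_measure]_(z in `[0%R, +oo[)
             (z `^ (n%:R / 2 - 1) * g z)%:E < +oo)%E].

Definition ell_const (R : realType) (n : nat) (g : R -> R) : R :=
  Gamma (n%:R / 2) / pi `^ (n%:R / 2) *
  (\int[lebesgue_measure]_(z in `[0, +oo[) (z `^ (n%:R / 2 - 1) * g z))^-1.

(* Z ~ ELL_n(0, I_n, g) *)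
Definition ell_std (d : measure_display) (T : measurableType d)
    (R : realType) (P : probability T R) (n : nat) (g : R -> R)
    (Z : {RV P >-> n.-tuple R}) : Prop :=
  is_density_generator n g /\
  forall A : set (n.-tuple R), measurable A ->
    distribution P Z A =
    (\int[lebesgue_tuple R n]_(z in A)
       (ell_const n g * g (dotv (colv z) (colv z)))%:E)%E.

(* The right-hand side of the formula for phi(u^2), for 0 < u. *)
Definition ell_phi_rhs (R : realType) (n : nat) (g : R -> R) (u : R) : R :=
  ell_const n g * (2 * pi) `^ (n%:R / 2) * u `^ (- ((n%:R - 2) / 2)) *
  \int[lebesgue_measure]_(r in `[0, +oo[)
    (r `^ (n%:R / 2) * besselJ ((n%:R - 2) / 2) (r * u) * g (r ^+ 2)).

(* phi on [0, +oo[; u `^ (- nu) is singular or degenerate at u = 0, hence the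
   one-sided limit. *)
Definition ell_phi (R : realType) (n : nat) (g : R -> R) (s : R) : R :=
  if s == 0 then lim (ell_phi_rhs n g u @[u --> 0^'+])
  else ell_phi_rhs n g (Num.sqrt s).

(* Main.v *)
Require Import Defs.
From HB Require Import structures.
From mathcomp Require Import all_boot all_order all_algebra.
From mathcomp Require Import all_classical all_reals all_analysis.
From mathcomp.real_closed Require Import complex.
From mathcomp Require Import measurable_realfun.
From mathcomp Require Import ring lra.

Set Implicit Arguments.
Unset Strict Implicit.
Unset Printing Implicit Defensive.

Import Order.TTheory GRing.Theory Num.Theory.
Import numFieldNormedType.Exports.
Local Open Scope classical_set_scope.
Local Open Scope ring_scope.

(** Conditioning on V = v reduces the claim to the characteristic function of Z
    at w = sqrt v Sigma^(1/2) t, for which |w|^2 = v t' Sigma t. So the point is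
      int_{R^n} G(|z|^2) e^(i w.z) dz = int_0^oo G(s) h_{n,|w|^2}(s) ds,
      h_{n,b}(s) = pi^(n/2) sum_k (- b/4)^k / k! * s^(n/2+k-1) / Gamma(n/2+k),
    because the substitution s = r^2 turns the right-hand side into the Bessel
    integral that defines phi ([ell_phi_rhsE]).

    The identity is proved by induction on n ([integral_radial_wave]). Splitting
    off one coordinate reduces it to the convolution identity
    h_{1,a} * h_{n,b} = h_{n+1,a+b} ([conv_sphker]). This holds because the
    kernels s^(a-1) / Gamma(a) form a semigroup for convolution, which is the
    formula for the Beta integral ([conv_rlker]), and because the coefficients
    a^j / j! and b^k / k! recombine by the binomial theorem. In dimension 1,
    h_{1,w^2}(s) = cos(w sqrt s) / sqrt s is simply the density of the image of
    cos(w x) dx under x |-> x^2 ([sphker1]).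

    Two devices keep the measure theory elementary. Cosines carry an arbitrary
    phase theta, so that real and imaginary parts are treated at once and the
    induction closes. And 1 + cos, or more generally A + B cos with |B| <= A,
    replaces cos: all integrands are then nonnegative, so that Tonelli applies,
    and the constant is subtracted only at the end, where the total mass is that
    of a probability.

    At u = 0 the formula for phi is read as a limit, which is 1 by dominated
    convergence ([cvg_bmean]), as it should be for a characteristic function
    at 0. *)

(** * Densities and changes of variables *)

Section density.
Local Open Scope ereal_scope.
Context d (T : measurableType d) (R : realType).
Variables (mu : {measure set T -> \bar R}) (rho : T -> R).
Hypotheses (mrho : measurable_fun setT rho) (rho0 : forall x, (0 <= rho x)%R).

Definition with_density (A : set T) : \bar R := \int[mu]_(x in A) (rho x)%:E.

Let with_density0 : with_density set0 = 0.
Proof. by rewrite /with_density integral_set0. Qed.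

Let with_density_ge0 A : 0 <= with_density A.
Proof. by apply: integral_ge0 => x _; rewrite lee_fin. Qed.

Let with_density_sigma_additive : semi_sigma_additive with_density.
Proof.
move=> F mF tF mUF; rewrite /with_density ge0_integral_bigcup//; last 2 first.
- exact/measurable_EFinP/measurable_funTS.
- by move=> x _; rewrite lee_fin.
apply: is_cvg_ereal_nneg_natsum_cond => n _ _.
by apply: integral_ge0 => x _; rewrite lee_fin.
Qed.

HB.instance Definition _ := isMeasure.Build _ _ _ with_density
  with_density0 with_density_ge0 with_density_sigma_additive.

Import HBNNSimple.

Lemma ge0_integral_with_density (f : T -> \bar R) :
  measurable_fun setT f -> (forall x, 0 <= f x) ->
  \int[with_density]_x f x = \int[mu]_x (f x * (rho x)%:E).
Proof.
move=> mf f0.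
(* Both sides are monotone limits along simple functions; on indicators the
   identity is the definition of the measure. *)
pose f_ := nnsfun_approx measurableT mf.
have ndf x : {homo (fun n => f_ n x) : m n / (m <= n)%N >-> (m <= n)%R}.
  by move=> m n mn; exact/lefP/nd_nnsfun_approx.
have cf x : (EFin \o f_ ^~ x) n @[n --> \oo] --> f x.
  by apply: cvg_nnsfun_approx => // y _; exact: f0.
transitivity (limn (fun n => \int[with_density]_x (f_ n x)%:E)).
  rewrite -monotone_convergence//.
  - by apply: eq_integral => x _; apply/esym/cvg_lim => //; exact: cf.
  - by move=> n; exact/measurable_EFinP.
  - by move=> n x _; rewrite lee_fin.
  - by move=> x _ m n mn; rewrite lee_fin; exact: ndf.
transitivity (limn (fun n => \int[mu]_x ((f_ n x)%:E * (rho x)%:E))); last first.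
  rewrite -monotone_convergence//.
  - apply: eq_integral => x _; apply/cvg_lim => //.
    by apply: cvgeZr => //; exact: cf.
  - by move=> n; apply: emeasurable_funM; exact/measurable_EFinP.
  - by move=> n x _; rewrite mule_ge0// lee_fin.
  - move=> x _ m n mn; rewrite -!EFinM lee_fin ler_wpM2r//; exact: ndf.
congr (limn _); apply/funext => n.
under [LHS]eq_integral do rewrite fimfunE -fsumEFin//.
rewrite ge0_integral_fsum//; last 2 first.
- by move=> r; exact/measurable_EFinP/measurable_funM.
- by move=> r x _; rewrite nnfun_muleindic_ge0.
under [RHS]eq_integral => x _.
  rewrite fimfunE -fsumEFin// ge0_mule_fsuml; last first.
    by move=> r; rewrite nnfun_muleindic_ge0.
  over.
rewrite ge0_integral_fsum//; last 2 first.
- move=> r; apply: emeasurable_funM; last exact/measurable_EFinP.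
  exact/measurable_EFinP/measurable_funM.
- by move=> r x _; rewrite mule_ge0 ?nnfun_muleindic_ge0 ?lee_fin.
apply: eq_fsbigr => r _.
rewrite integralZl_indic_nnsfun// integral_indic// setIT.
under [RHS]eq_integral do rewrite EFinM -muleA.
have [r0|r0] := ltP r 0%R.
  rewrite preimage_nnfun0// /= measure0 mule0.
  by rewrite integral0_eq// => x _; rewrite indic0 mul0e mule0.
rewrite ge0_integralZl_EFin//; last 2 first.
- by move=> x _; rewrite mule_ge0// lee_fin.
- by apply: emeasurable_funM; exact/measurable_EFinP.
congr (_ * _); rewrite /= /with_density integral_mkcond.
apply: eq_integral => x _.
by rewrite patchE indicE; case: ifP => _; rewrite ?mul1e ?mul0e.
Qed.

End density.

(** A change of variables only has to be checked on the intervals ]a, b],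
    because two measures that agree on these are equal. *)
Lemma ge0_integral_change_of_variables (R : realType) (phi rho : R -> R)
    (f : R -> \bar R) :
  measurable_fun setT phi -> measurable_fun setT rho -> (forall x, 0 <= rho x) ->
  (forall a b, a < b ->
    (\int[lebesgue_measure]_(x in phi @^-1` `]a, b]) (rho x)%:E = (b - a)%:E)%E) ->
  measurable_fun setT f -> (forall x, 0 <= f x)%E ->
  (\int[lebesgue_measure]_x f x =
   \int[lebesgue_measure]_x (f (phi x) * (rho x)%:E))%E.
Proof.
move=> mphi mrho rho0 H mf f0.
have mphi' : measurable_fun setT (phi : R -> measurableTypeR R) by [].
transitivity (\int[with_density lebesgue_measure rho]_x (f \o phi) x)%E; last first.
  apply: ge0_integral_with_density => //; first exact: measurableT_comp.
  by move=> x; exact: f0.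
transitivity (\int[pushforward (with_density lebesgue_measure rho)
    (phi : R -> measurableTypeR R)]_x f x)%E; last first.
  by rewrite ge0_integral_pushforward//; exact: measurableT_comp.
apply: eq_measure_integral => A mA _.
apply: (@lebesgue_measure_unique R
  (measure_function_pushforward__canonical__measure_function_Measure
    (@with_density _ _ _ (@lebesgue_measure R) rho) mphi')) => //= _ [[a b] _ <-].
rewrite /pushforward /with_density.
rewrite lebesgue_measure_itv/= lte_fin; case: ltP => ab; first by rewrite H.
rewrite (_ : phi @^-1` _ = set0) ?integral_set0//.
apply/seteqP; split => x //=; rewrite in_itv/=.
by case/andP => /lt_le_trans h/h; rewrite ltNge ab.
Qed.

Section substitutions.
Context {R : realType}.
Local Notation leb := (@lebesgue_measure R).
Implicit Types f : R -> \bar R.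

Let integral_bnd_cst (u v : bool) (a b c : R) : a <= b ->
  (\int[leb]_(x in [set` Interval (BSide u a) (BSide v b)]) c%:E = (c * (b - a))%:E)%E.
Proof.
move=> ab; rewrite integral_cst//= lebesgue_measure_itv/= lte_fin EFinM.
by case: ltP => // ba; rewrite (_ : b = a) ?subrr//; apply/eqP; rewrite eq_le ba ab.
Qed.

Lemma ge0_integral_affine (a b : R) f : 0 < a ->
  measurable_fun setT f -> (forall x, 0 <= f x)%E ->
  (\int[leb]_x f x = \int[leb]_x (f (a * x + b)%R * a%:E))%E.
Proof.
move=> a0 mf f0.
apply: (@ge0_integral_change_of_variables R (fun x => a * x + b) (cst a)) => //.
- by apply: measurable_funD => //; exact: measurable_funM.
- by move=> x; exact: ltW.
move=> u v uv; rewrite (_ : _ @^-1` _ = `](u - b) / a, (v - b) / a]%classic).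
  rewrite /= integral_bnd_cst.
    by congr (_%:E); field; rewrite gt_eqF.
  by rewrite ler_pM2r ?invr_gt0// lerD2r ltW.
apply/seteqP; split => x /=; rewrite !in_itv/= ltr_pdivrMr// ler_pdivlMr//;
  by rewrite ltrBlDr lerBrDr (mulrC x).
Qed.

Lemma ge0_integral_translate (b : R) f :
  measurable_fun setT f -> (forall x, 0 <= f x)%E ->
  (\int[leb]_x f x = \int[leb]_x f (x + b)%R)%E.
Proof.
move=> mf f0; rewrite (ge0_integral_affine b ltr01)//.
by apply: eq_integral => x _; rewrite mul1r mule1.
Qed.

Lemma integral_itv_expr (n : nat) (a b : R) : a < b ->
  (\int[leb]_(x in `]a, b]) (n.+1%:R * x ^+ n)%:E = (b ^+ n.+1 - a ^+ n.+1)%:E)%E.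
Proof.
move=> ab; rewrite integral_itv_obnd_cbnd; last first.
  apply/measurable_EFinP/measurable_funTS; apply: measurable_funM => //.
rewrite (@continuous_FTC2 R (fun x => n.+1%:R * x ^+ n) (fun x => x ^+ n.+1))//.
- apply: continuous_subspaceT => x; apply: cvgM; first exact: cvg_cst.
  exact: exprn_continuous.
- split.
  + by move=> x _; exact: exprn_derivable.
  + by apply: cvg_at_right_filter; exact: exprn_continuous.
  + by apply: cvg_at_left_filter; exact: exprn_continuous.
- by move=> x _; rewrite exp_derive1.
Qed.

(** The substitution s = r^2 is completed to a bijection of the line by the
    identity of the negative half-line. *)
Lemma ge0_integral_sqr f :
  measurable_fun setT f -> (forall x, 0 <= f x)%E ->
  (\int[leb]_(s in `]0%R, +oo[) f s =
   \int[leb]_(r in `]0%R, +oo[) (f (r ^+ 2)%R * (2 * r)%:E))%E.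
Proof.
move=> mf f0.
have mif (u v : R -> R) : measurable_fun setT u -> measurable_fun setT v ->
    measurable_fun setT (fun r : R => if 0 < r then u r else v r).
  by move=> mu mv; apply: measurable_fun_ifT => //; exact: measurable_fun_ltr.
pose phi (r : R) := if 0 < r then r ^+ 2 else r.
pose rho (r : R) := if 0 < r then 2 * r else 1.
have rho0 x : 0 <= rho x.
  by rewrite /rho; case: (ltP 0 x) => // x0; rewrite mulr_ge0// ltW.
rewrite integral_mkcond (@ge0_integral_change_of_variables R phi rho).
- rewrite [RHS]integral_mkcond; apply: eq_integral => r _.
  rewrite !patchE /phi /rho !mem_setE !in_itv/= !andbT.
  by case: (ltP 0 r) => r0; [rewrite exprn_gt0|rewrite ltNge r0/= mul0e].
- apply: mif => //.
- by apply: mif => //; exact: measurable_funM.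
- exact: rho0.
- move=> a b ab.
  (* Num.sqrt vanishes on negative numbers, so this covers all signs of a and b. *)
  have -> : phi @^-1` `]a, b] = `]a, Num.min b 0] `|` `]Num.sqrt a, Num.sqrt b].
    apply/seteqP; split => x; rewrite /= /phi !in_itv/= le_min.
      case: (ltP 0 x) => x0 /andP[h1 h2]; [right|left; rewrite h1 h2//].
      have b0 : 0 <= b by rewrite (le_trans _ h2)// sqr_ge0.
      rewrite -(ger0_norm (ltW x0)) -!sqrtr_sqr.
      by rewrite ltr_sqrt ?exprn_gt0// h1 ler_sqrt.
    case=> [/andP[ax /andP[xb x0]]|/andP[ax xb]]; first by rewrite (ltNge 0 x) x0/= ax.
    have x0 : 0 < x by rewrite (le_lt_trans _ ax)// sqrtr_ge0.
    rewrite x0; have xE : x = Num.sqrt (x ^+ 2) by rewrite sqrtr_sqr gtr0_norm.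
    move: ax xb; rewrite {1 2}xE ltr_sqrt ?exprn_gt0// => -> /=.
    case: (leP 0 b) => b0; first by rewrite ler_sqrt.
    by rewrite -xE ler0_sqrtr ?(ltW b0)// leNgt x0.
  rewrite ge0_integral_setU//; last 3 first.
  + apply/measurable_EFinP/measurable_funTS.
    by apply: mif => //; exact: measurable_funM.
  + by move=> x _; rewrite lee_fin /rho; case: ltP => // x0; rewrite mulr_ge0// ltW.
  + apply/disj_setPLR => x /=; rewrite !in_itv/= le_min => /andP[ax /andP[xb x0]].
    by apply/negP; rewrite negb_and -!leNgt (le_trans x0)// sqrtr_ge0.
  have -> : (\int[leb]_(x in `]a, Num.min b 0%R]) (rho x)%:E =
             (Num.min b 0 - Num.min a 0)%R%:E)%E.
    transitivity (\int[leb]_(x in `]a, Num.min b 0%R]) (cst 1%E x))%E.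
      apply: eq_integral => x; rewrite inE/= in_itv/= le_min => /andP[_ /andP[_ x0]].
      by rewrite /rho (ltNge 0 x) x0.
    case: (leP 0 a) => a0; last first.
      by rewrite integral_bnd_cst ?mul1r ?(min_idPl (ltW a0))// le_min (ltW ab) ltW.
    rewrite set_itv_ge ?integral_set0 ?bnd_simp -?leNgt ?ge_min ?a0 ?orbT//.
    by rewrite !(min_idPr _) ?subrr// (le_trans a0)// ltW.
  have -> : (\int[leb]_(x in `]Num.sqrt a, Num.sqrt b]) (rho x)%:E =
             (Num.max b 0 - Num.max a 0)%R%:E)%E.
    transitivity (\int[leb]_(x in `]Num.sqrt a, Num.sqrt b]) (2 * x ^+ 1)%:E)%E.
      apply: eq_integral => x; rewrite inE/= in_itv/= => /andP[ax _].
      by rewrite /rho (le_lt_trans (sqrtr_ge0 _) ax).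
    have sqrE (c : R) : Num.max c 0 = Num.sqrt c ^+ 2.
      by case: (leP 0 c) => c0; [rewrite sqr_sqrtr|rewrite ler0_sqrtr ?expr0n// ltW].
    have [sab|] := ltP (Num.sqrt a) (Num.sqrt b); first by rewrite integral_itv_expr// !sqrE.
    move=> sba; rewrite set_itv_ge ?bnd_simp -?leNgt// integral_set0.
    rewrite !sqrE (_ : Num.sqrt b = Num.sqrt a) ?subrr//.
    by apply/eqP; rewrite eq_le sba ler_wsqrtr// ltW.
  by rewrite -EFinD; congr (_%:E); case: (leP b 0) => b0; case: (leP a 0) => a0;
    ring.
- by apply/(measurable_restrictT _ _).1 => //; exact: measurable_funTS.
- by move=> x; rewrite patchE; case: ifPn.
Qed.

End substitutions.

(** * The Gamma function at half-integers *)

Section gamma_half.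
Context {R : realType}.
Local Notation leb := (@lebesgue_measure R).

(** Extended by 0 to the whole line, so that the convolution of two powers is an
    integral over the line whose domain takes care of itself. *)
Definition ppow (a s : R) : R := if 0 < s then s `^ (a - 1) else 0.

Lemma ppow_ge0 a s : 0 <= ppow a s.
Proof. by rewrite /ppow; case: ifP => // _; exact: powR_ge0. Qed.

Lemma ppow_le0 a s : s <= 0 -> ppow a s = 0.
Proof. by rewrite /ppow leNgt => /negbTE ->. Qed.

Lemma measurable_ppow a : measurable_fun setT (ppow a).
Proof.
apply: measurable_fun_ifT => //; first exact: measurable_fun_ltr.
Qed.

Lemma ppowM a c s : 0 < c -> ppow a (c * s) = c `^ (a - 1) * ppow a s.
Proof.
move=> c0; rewrite /ppow pmulr_rgt0//; case: ltP => s0; last by rewrite mulr0.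
by rewrite powRM// ltW.
Qed.

(** Euler's integral before its finiteness is known. *)
Definition egamma (a : R) : \bar R :=
  (\int[leb]_t (ppow a t * expR (- t))%:E)%E.

Lemma Gamma_egamma a : Gamma a = fine (egamma a).
Proof.
rewrite /Gamma /Rintegral /egamma; congr fine; rewrite integral_mkcond.
apply: eq_integral => t _; rewrite patchE mem_setE in_itv/= andbT /ppow.
by case: ifP => // _; rewrite mul0r.
Qed.

Lemma Gamma_ge0 (a : R) : 0 <= Gamma a.
Proof.
rewrite Gamma_egamma; apply: fine_ge0; apply: integral_ge0 => t _.
by rewrite lee_fin mulr_ge0 ?ppow_ge0 ?expR_ge0.
Qed.

Lemma measurable_gamma a : measurable_fun setT (fun t : R => ppow a t * expR (- t)).
Proof.
apply: measurable_funM; first exact: measurable_ppow.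
by apply: measurableT_comp => //; exact: measurableT_comp.
Qed.

Lemma powR_half (x : R) (n : nat) : 0 <= x -> x `^ (n%:R / 2) = Num.sqrt x ^+ n.
Proof.
by move=> x0; rewrite mulrC powRrM -powR12_sqrt// powR_mulrn// powR_ge0.
Qed.

Lemma powR_half_sqr (x : R) (n : nat) : 0 <= x -> (x ^+ 2) `^ (n%:R / 2) = x ^+ n.
Proof. by move=> x0; rewrite powR_half ?sqr_ge0// sqrtr_sqr ger0_norm. Qed.

(** Squaring turns the possibly singular power s^(m/2 - 1) into a polynomial. *)
Lemma integral_ppow_half (m : nat) (t : R) : 0 < t ->
  (\int[leb]_(s in `]0%R, t]) (m.+1%:R / 2 * ppow (m.+1%:R / 2) s)%:E
    = (t `^ (m.+1%:R / 2))%:E)%E.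
Proof.
move=> t0.
pose f s : \bar R :=
  ((m.+1%:R / 2 * ppow (m.+1%:R / 2) s) * \1_(`]-oo, t] : set R) s)%:E.
have -> : (\int[leb]_(s in `]0%R, t]) (m.+1%:R / 2 * ppow (m.+1%:R / 2) s)%:E =
   \int[leb]_(s in `]0%R, +oo[) f s)%E.
  rewrite integral_mkcond [RHS]integral_mkcond; apply: eq_integral => s _.
  rewrite !patchE /f indicE !mem_setE !in_itv/= andbT.
  by case: ltP => // s0; case: leP => ?; rewrite /= ?mulr1 ?mulr0.
rewrite ge0_integral_sqr//; last 2 first.
- apply/measurable_EFinP; apply: measurable_funM => //.
  by apply: measurable_funM => //; exact: measurable_ppow.
- by move=> x; rewrite lee_fin mulr_ge0// mulr_ge0// ppow_ge0.
transitivity (\int[leb]_(r in `]0%R, Num.sqrt t]) (m.+1%:R * r ^+ m)%:E)%E; last first.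
  by rewrite integral_itv_expr ?sqrtr_gt0// expr0n subr0 powR_half// ltW.
rewrite integral_mkcond [RHS]integral_mkcond; apply: eq_integral => r _.
rewrite !patchE /f indicE !mem_setE !in_itv/= andbT.
case: (ltP 0 r) => //= r0.
have -> : (r <= Num.sqrt t) = (r ^+ 2 <= t).
  by rewrite -[in RHS](sqr_sqrtr (ltW t0)) ler_sqr ?nnegrE ?sqrtr_ge0// ltW.
case: leP => _ /=; last by rewrite mulr0 mul0e.
rewrite -EFinM; congr EFin; rewrite mulr1 /ppow exprn_gt0// powRB ?powRr1 ?sqr_ge0//.
  rewrite powR_half_sqr ?(ltW r0)// exprS; field; exact: lt0r_neq0.
by rewrite sqrf_eq0 (gt_eqF r0) implybT.
Qed.

End gamma_half.

Lemma tonelli (R : realType) (d1 d2 : measure_display) (T1 : measurableType d1)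
    (T2 : measurableType d2) (m1 : {sigma_finite_measure set T1 -> \bar R})
    (m2 : {sigma_finite_measure set T2 -> \bar R}) (f : T1 -> T2 -> \bar R) :
  measurable_fun setT (fun z => f z.1 z.2) -> (forall x y, 0 <= f x y)%E ->
  (\int[m1]_x \int[m2]_y f x y = \int[m2]_y \int[m1]_x f x y)%E.
Proof.
by move=> mf f0; rewrite (@fubini_tonelli _ _ _ _ _ m1 m2 (fun z => f z.1 z.2)).
Qed.

Section gamma_recurrence.
Context {R : realType}.
Local Notation leb := (@lebesgue_measure R).

Lemma integral_expRN (s : R) :
  (\int[leb]_(t in `[s, +oo[) (expR (- t))%:E = (expR (- s))%:E)%E.
Proof.
have cN : continuous (fun t : R => expR (- t)).
  by move=> t; apply: continuous_comp; [exact: continuousN|exact: continuous_expR].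
rewrite (@ge0_continuous_FTC2y R _ (fun t => - expR (- t)) s 0).
- by rewrite -EFinD opprK add0r.
- by move=> x _; exact: expR_ge0.
- exact: continuous_subspaceT.
- rewrite -oppr0; apply: cvgN; exact: cvgr_expR.
- by move=> x _; exact: ex_derive.
- by apply: cvg_at_right_filter; apply: cvgN; exact: cN.
- move=> x _; rewrite derive1E.
  by rewrite derive_val mulrN1 opprK.
Qed.

(** Tonelli in place of an integration by parts: t^a is the integral of
    a s^(a-1) over ]0, t], and the integral of e^-t over [s, +oo[ is e^-s. *)
Lemma egamma_half_succ (m : nat) (a := m.+1%:R / 2 : R) :
  egamma (a + 1) = (a%:E * egamma a)%E.
Proof.
have a0 : 0 < a by rewrite divr_gt0.
pose f (t s : R) : \bar R := (a * ppow a s * (s <= t)%R%:R * expR (- t))%:E.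
have f0 t s : (0 <= f t s)%E.
  by rewrite lee_fin !mulr_ge0 ?ppow_ge0 ?expR_ge0 ?ler0n ?(ltW a0).
have mf : measurable_fun setT (fun z => f z.1 z.2).
  apply/measurable_EFinP; apply: measurable_funM; last first.
    by apply: measurableT_comp => //; exact: measurableT_comp.
  apply: measurable_funM.
    by apply: measurable_funM => //; apply: measurableT_comp => //; exact: measurable_ppow.
  apply: measurableT_comp => //; exact: measurable_fun_ler.
transitivity (\int[leb]_t \int[leb]_s f t s)%E.
  apply: eq_integral => t _.
  have -> : (\int[leb]_s f t s = (expR (- t))%:E *
      \int[leb]_(s in `]0%R, t]) (a * ppow a s)%:E)%E.
    rewrite [in RHS]integral_mkcond -ge0_integralZl_EFin ?expR_ge0//; last 2 first.
    - move=> s _; rewrite patchE; case: ifP => // _.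
      by rewrite lee_fin mulr_ge0 ?ppow_ge0// ltW.
    - apply/(measurable_restrictT _ _).1 => //; apply/measurable_EFinP/measurable_funTS.
      by apply: measurable_funM => //; exact: measurable_ppow.
    apply: eq_integral => s _; rewrite patchE mem_setE in_itv/= /f.
    have [s0|s0] := ltP 0%R s; last by rewrite ppow_le0//= mulr0 !mul0r mule0.
    by case: (leP s t) => _; rewrite /= ?mulr1 ?mulr0 ?mul0r ?mule0// mulrC.
  have [t0|t0] := ltP 0%R t; last first.
    rewrite ppow_le0// mul0r set_itv_ge ?integral_set0 ?mule0//.
    by rewrite bnd_simp -leNgt.
  by rewrite integral_ppow_half// -EFinM /ppow t0 addrK mulrC.
rewrite (tonelli leb leb mf)//.
rewrite -ge0_integralZl_EFin//; last 3 first.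
- by move=> t _; rewrite lee_fin mulr_ge0 ?ppow_ge0 ?expR_ge0.
- by apply/measurable_EFinP; exact: measurable_gamma.
- exact: ltW.
apply: eq_integral => s _.
transitivity (\int[leb]_(t in `[s, +oo[) ((a * ppow a s)%:E * (expR (- t))%:E))%E.
  rewrite [RHS]integral_mkcond; apply: eq_integral => t _.
  rewrite patchE mem_setE in_itv/= andbT /f.
  by case: (leP s t) => _; [rewrite mulr1 EFinM|rewrite mulr0 mul0r].
rewrite ge0_integralZl_EFin//; last 2 first.
- apply/measurable_EFinP/measurable_funTS.
  by apply: measurableT_comp => //; exact: measurableT_comp.
- by rewrite mulr_ge0 ?ppow_ge0// ltW.
by rewrite integral_expRN -!EFinM mulrA.
Qed.

(** The substitution t = r^2 gives the Gaussian integral. *)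
Lemma egamma_half1 : egamma (1 / 2) = (Num.sqrt pi)%:E :> \bar R.
Proof.
transitivity (\int[leb]_(t in `]0%R, +oo[) (ppow (1 / 2) t * expR (- t))%:E)%E.
  rewrite [RHS]integral_mkcond; apply: eq_integral => t _.
  by rewrite patchE mem_setE in_itv/= andbT; case: ltP => // t0; rewrite ppow_le0// mul0r.
rewrite ge0_integral_sqr//; last 2 first.
- by apply/measurable_EFinP; exact: measurable_gamma.
- by move=> x; rewrite lee_fin mulr_ge0 ?ppow_ge0 ?expR_ge0.
transitivity (\int[leb]_(r in `]0%R, +oo[) (2%:E * (gauss_fun r)%:E))%E.
  apply: eq_integral => r; rewrite inE/= in_itv/= andbT => r0.
  rewrite -!EFinM; congr EFin.
  rewrite /ppow exprn_gt0// powRB ?powRr1 ?sqr_ge0//; last first.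
    by rewrite sqrf_eq0 (gt_eqF r0) implybT.
  have -> : (r ^+ 2) `^ (1 / 2) = r := powR_half_sqr 1 (ltW r0).
  by rewrite /gauss_fun; field; exact: lt0r_neq0.
rewrite ge0_integralZl_EFin//; last 2 first.
- by move=> r _; rewrite lee_fin gauss_fun_ge0.
- by apply/measurable_EFinP/measurable_funTS; exact: measurable_gauss_fun.
rewrite integral_itv_obnd_cbnd; last first.
  by apply/measurable_EFinP/measurable_funTS; exact: measurable_gauss_fun.
by rewrite integral0y_gauss -EFinM; congr EFin; field.
Qed.

Lemma egamma1 : egamma 1 = 1%E :> \bar R.
Proof.
transitivity (\int[leb]_(t in `]0%R, +oo[) (expR (- t))%:E)%E.
  rewrite [RHS]integral_mkcond; apply: eq_integral => t _.
  rewrite patchE mem_setE in_itv/= andbT /ppow subrr powRr0.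
  by case: ltP => // _; rewrite ?mul1r ?mul0r.
rewrite integral_itv_obnd_cbnd; last first.
  apply/measurable_EFinP/measurable_funTS.
  by apply: measurableT_comp => //; exact: measurableT_comp.
by rewrite integral_expRN oppr0 expR0.
Qed.

(** Half-integers are the arguments at which dimension n evaluates Gamma; they
    are reached from 1/2 and 1 by the functional equation. *)
Lemma egamma_half (m : nat) :
  egamma (m.+1%:R / 2) = (Gamma (m.+1%:R / 2))%:E :> \bar R /\
  0 < Gamma (m.+1%:R / 2) :> R.
Proof.
suff [c ec c0] : exists2 c : R, egamma (m.+1%:R / 2) = c%:E & 0 < c.
  by rewrite Gamma_egamma ec.
elim/ltn_ind: m => -[_|[_|m]].
- by exists (Num.sqrt pi); [exact: egamma_half1|rewrite sqrtr_gt0 pi_gt0].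
- by exists 1 => //; rewrite divff ?egamma1// pnatr_eq0.
move=> /(_ m (ltnW (ltnSn _)))[c ec c0].
exists (m.+1%:R / 2 * c); last by rewrite mulr_gt0// divr_gt0.
rewrite EFinM -ec -egamma_half_succ; congr egamma.
by rewrite -[m.+3]addn2 natrD; field.
Qed.

Lemma Gamma_half_gt0 (m : nat) : (0 < m)%N -> 0 < Gamma (m%:R / 2) :> R.
Proof. by case: m => // m _; have [] := egamma_half m. Qed.

Lemma Gamma_half_succ (m : nat) : (0 < m)%N ->
  Gamma (m%:R / 2 + 1) = m%:R / 2 * Gamma (m%:R / 2) :> R.
Proof.
case: m => // m _; rewrite [LHS]Gamma_egamma egamma_half_succ.
by have [-> _] := egamma_half m.
Qed.

Lemma Gamma_half1 : Gamma (1 / 2) = Num.sqrt pi :> R.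
Proof. by rewrite Gamma_egamma egamma_half1. Qed.

End gamma_recurrence.

(** * The Riemann-Liouville semigroup *)

Section riemann_liouville.
Context {R : realType}.
Local Notation leb := (@lebesgue_measure R).

(** The Beta integral: the integrand vanishes outside ]0, 1[. *)
Definition ebeta (a b : R) : \bar R :=
  (\int[leb]_y (ppow a y * ppow b (1 - y))%:E)%E.

Let measurable_conv a b (s : R) :
  measurable_fun setT (fun x => ppow a x * ppow b (s - x)).
Proof.
apply: measurable_funM; first exact: measurable_ppow.
by apply: measurableT_comp; [exact: measurable_ppow|exact: measurable_funB].
Qed.

(** Scaling by s reduces the convolution at s to its value at 1. *)
Lemma conv_ppow (a b s : R) :
  (\int[leb]_x (ppow a x * ppow b (s - x))%:E = (ppow (a + b) s)%:E * ebeta a b)%E.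
Proof.
have [s0|s0] := ltP 0 s; last first.
  rewrite [X in (X%:E * _)%E]ppow_le0// mul0e integral0_eq// => x _.
  have [x0|x0] := ltP 0 x; last by rewrite ppow_le0// mul0r.
  by rewrite (@ppow_le0 _ b) ?mulr0//; lra.
rewrite (ge0_integral_affine 0 s0); last 2 first.
- by apply/measurable_EFinP; exact: measurable_conv.
- by move=> x; rewrite lee_fin mulr_ge0 ?ppow_ge0.
rewrite /ebeta -ge0_integralZl_EFin ?ppow_ge0//; last 2 first.
- by move=> x _; rewrite lee_fin mulr_ge0 ?ppow_ge0.
- by apply/measurable_EFinP; exact: measurable_conv.
apply: eq_integral => y _; rewrite addr0 -!EFinM; congr EFin.
rewrite (_ : s - s * y = s * (1 - y)); last by ring.
rewrite !ppowM// (_ : ppow (a + b) s = s `^ (a + b - 1)); last by rewrite /ppow s0.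
rewrite (_ : a + b - 1 = (a - 1) + (b - 1) + 1); last by ring.
move: (a - 1) (b - 1) => u v.
by rewrite !powRD ?(gt_eqF s0) ?implybT// powRr1 ?ltW//; ring.
Qed.

(** Shifting y to s - x in the product of two Euler integrals pulls out the
    factor e^-s and leaves a convolution. *)
Lemma egammaM (a b : R) : (egamma a * egamma b = egamma (a + b) * ebeta a b)%E.
Proof.
have mg c : measurable_fun setT (fun t : R => (ppow c t * expR (- t))%:E).
  by apply/measurable_EFinP; exact: measurable_gamma.
have g0 c (t : R) : (0 <= (ppow c t * expR (- t))%:E)%E.
  by rewrite lee_fin mulr_ge0 ?ppow_ge0 ?expR_ge0.
have eg0 c : (0 <= egamma c :> \bar R)%E by apply: integral_ge0 => t _; exact: g0.
rewrite {1}/egamma -ge0_integralZr//; last exact: (mg a).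
transitivity (\int[leb]_x \int[leb]_s
   (ppow a x * ppow b (s - x) * expR (- s))%:E)%E.
  apply: eq_integral => x _; rewrite /egamma -ge0_integralZl//; last exact: (mg b).
  rewrite [LHS](ge0_integral_translate (- x)); last 2 first.
  - have mgx : measurable_fun setT (fun y : R =>
        ((ppow a x * expR (- x))%:E * (ppow b y * expR (- y))%:E)%E).
      by apply: emeasurable_funM => //; exact: measurable_cst.
    exact: mgx.
  - by move=> y; rewrite mule_ge0.
  apply: eq_integral => s _; rewrite -EFinM; congr EFin.
  rewrite (_ : - s = - x + - (s - x)); last by ring.
  by rewrite expRD; ring.
rewrite (@tonelli R _ _ _ _ leb leb (fun x s =>
  (ppow a x * ppow b (s - x) * expR (- s))%:E)); last 2 first.
- apply/measurable_EFinP; apply: measurable_funM; last first.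
    by apply: measurableT_comp => //; exact: measurableT_comp.
  apply: measurable_funM; apply: measurableT_comp => //; try exact: measurable_ppow.
  exact: measurable_funB.
- by move=> x y; rewrite lee_fin !mulr_ge0 ?ppow_ge0 ?expR_ge0.
rewrite {1}/egamma -ge0_integralZr//; last 2 first.
- exact: (mg (a + b)).
- by apply: integral_ge0 => t _; rewrite lee_fin mulr_ge0 ?ppow_ge0.
apply: eq_integral => s _.
transitivity (\int[leb]_x ((expR (- s))%:E * (ppow a x * ppow b (s - x))%:E))%E.
  by apply: eq_integral => x _; rewrite -EFinM mulrC.
rewrite ge0_integralZl_EFin; last 4 first.
- exact: measurableT.
- by move=> t _; rewrite lee_fin mulr_ge0 ?ppow_ge0.
- by apply/measurable_EFinP; exact: measurable_conv.
- exact: expR_ge0.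
by rewrite conv_ppow muleA -EFinM mulrC.
Qed.

(** The kernel s^(m/2 - 1) / Gamma(m/2) of the Riemann-Liouville integral of
    half-integral order m/2. *)
Definition rlker (m : nat) (s : R) : R := ppow (m%:R / 2) s / Gamma (m%:R / 2).

Lemma rlker_ge0 m s : 0 <= rlker m s.
Proof. by rewrite divr_ge0 ?ppow_ge0 ?Gamma_ge0. Qed.

Lemma measurable_rlker m : measurable_fun setT (rlker m).
Proof. by apply: measurable_funM => //; exact: measurable_ppow. Qed.

Lemma rlker_le0 m s : s <= 0 -> rlker m s = 0.
Proof. by move=> s0; rewrite /rlker ppow_le0 ?mul0r. Qed.

Lemma measurable_conv_rlker m l (s : R) :
  measurable_fun setT (fun x => rlker m x * rlker l (s - x)).
Proof.
apply: measurable_funM; first exact: measurable_rlker.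
by apply: measurableT_comp; [exact: measurable_rlker|exact: measurable_funB].
Qed.

(** The semigroup law of fractional integration; it is the formula for the
    Beta integral. *)
Lemma conv_rlker (m l : nat) (s : R) : (0 < m)%N -> (0 < l)%N ->
  (\int[leb]_x (rlker m x * rlker l (s - x))%:E = (rlker (m + l) s)%:E)%E.
Proof.
case: m => // m _; case: l => // l _.
set c := (Gamma (m.+1%:R / 2) * Gamma (l.+1%:R / 2))^-1 : R.
have [em m0] := @egamma_half R m; have [el l0] := @egamma_half R l.
have [eml ml0] := @egamma_half R (m + l.+1).
have c0 : 0 <= c by rewrite invr_ge0; apply: mulr_ge0; exact: Gamma_ge0.
transitivity (\int[leb]_x (c%:E *
    (ppow (m.+1%:R / 2) x * ppow (l.+1%:R / 2) (s - x))%:E))%E.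
  apply: eq_integral => x _; rewrite -EFinM; congr EFin.
  by rewrite /rlker /c invfM; ring.
rewrite ge0_integralZl_EFin//; last 2 first.
- by move=> t _; rewrite lee_fin mulr_ge0 ?ppow_ge0.
- by apply/measurable_EFinP; exact: measurable_conv.
rewrite conv_ppow.
have := egammaM (m.+1%:R / 2) (l.+1%:R / 2); rewrite em el.
rewrite -mulrDl -natrD eml; case: (ebeta _ _) => [r| |].
- rewrite -!EFinM => -[cE]; congr EFin; rewrite /c cE /rlker.
  have r0 : r != 0.
    apply/eqP => rz; move: cE; rewrite rz mulr0 => /eqP.
    by rewrite (gt_eqF (mulr_gt0 m0 l0)).
  by field; rewrite r0 gt_eqF.
- by rewrite gt0_muley ?lte_fin.
- by rewrite gt0_muleNy ?lte_fin.
Qed.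

Lemma rlkerSS (m : nat) (s : R) : (0 < m)%N ->
  rlker m.+2 s = s / (m%:R / 2) * rlker m s.
Proof.
move=> m0; rewrite /rlker /ppow; case: ltP => s0; last by rewrite !mul0r mulr0.
have G0 := @Gamma_half_gt0 R m m0.
have mE : m.+2%:R / 2 = m%:R / 2 + 1 :> R by rewrite -[m.+2]addn2 natrD; field.
rewrite mE Gamma_half_succ// (_ : m%:R / 2 + 1 - 1 = m%:R / 2 - 1 + 1); last by ring.
rewrite [_ `^ (_ + 1)]powRD ?(gt_eqF s0) ?implybT// powRr1 ?ltW//; field.
by rewrite (gt_eqF G0) pnatr_eq0 -lt0n.
Qed.

(** Each step m -> m + 2 multiplies the kernel by s / (m/2) <= 2 s; this makes
    the Bessel series converge like an exponential one. *)
Lemma rlker_bound (m k : nat) (s : R) : (0 < m)%N ->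
  rlker (m + k.*2) s <= (2 * s) ^+ k * rlker m s.
Proof.
move=> m0; have [s0|s0] := ltP 0 s; last by rewrite !rlker_le0// mulr0.
elim: k => [|k ih]; first by rewrite addn0 mul1r.
rewrite doubleS !addnS rlkerSS ?ltn_addr// exprS -[leRHS]mulrA.
apply: ler_pM => //; first by rewrite divr_ge0// ltW.
  by rewrite rlker_ge0.
rewrite ler_pdivrMr ?divr_gt0 ?ltr0n ?ltn_addr//.
have : 1 <= (m + k.*2)%:R :> R by rewrite ler1n ltn_addr.
by nra.
Qed.

End riemann_liouville.

(** * Cauchy products of exponential series *)

Section cauchy_product.
Context {R : realType}.
Implicit Types F G : nat -> nat -> R.

Definition square_sum F (N : nat) : R :=
  \sum_(0 <= j < N) \sum_(0 <= k < N) F j k.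

Definition triangle_sum F (N : nat) : R :=
  \sum_(0 <= n < N) \sum_(0 <= j < n.+1) F j (n - j)%N.

Lemma triangle_sumE F N :
  triangle_sum F N = \sum_(0 <= j < N) \sum_(0 <= k < N - j) F j k.
Proof.
elim: N => [|N ih]; first by rewrite /triangle_sum !big_nil.
rewrite /triangle_sum big_nat_recr//= -/(triangle_sum F N) ih.
rewrite [in RHS]big_nat_recr//= subSnn big_nat1.
rewrite [in LHS]big_nat_recr//= subnn addrA; congr (_ + _).
rewrite -big_split/=; apply: eq_big_nat => j /andP[_ jN].
by rewrite subSn ?(ltnW jN)// big_nat_recr.
Qed.

Lemma square_subr_triangle F N : square_sum F N - triangle_sum F N =
  \sum_(0 <= j < N) \sum_(N - j <= k < N) F j k.
Proof.
rewrite triangle_sumE /square_sum -sumrB; apply: eq_big_nat => j /andP[_ jN].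
rewrite (@big_cat_nat _ _ _ (N - j)%N) ?leq_subr//=.
by rewrite addrAC subrr add0r.
Qed.

(** The difference is a sum over the corner j, k < N <= j + k, so it can be
    majorized term by term. *)
Lemma square_subr_triangle_le F G N : (forall j k, `|F j k| <= G j k) ->
  `|square_sum F N - triangle_sum F N| <= square_sum G N - triangle_sum G N.
Proof.
move=> FG; rewrite !square_subr_triangle.
apply: le_trans (ler_norm_sum _ _ _) _; apply: ler_sum => j _.
by apply: le_trans (ler_norm_sum _ _ _) _; apply: ler_sum => k _.
Qed.

(** The binomial theorem, one diagonal at a time. *)
Lemma triangle_sum_exp (q : nat -> R) (a b : R) N :
  triangle_sum (fun j k => a ^+ j / j`!%:R * (b ^+ k / k`!%:R) * q (j + k)%N) N =
  \sum_(0 <= n < N) (a + b) ^+ n / n`!%:R * q n.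
Proof.
apply: eq_bigr => n _; rewrite addrC exprDn !mulr_suml big_mkord.
apply: eq_bigr => -[j jn] _ /=; rewrite subnKC//.
rewrite -[_ *+ 'C(_, _)]mulr_natr; congr (_ * _).
have fj (i : nat) : i`!%:R != 0 :> R by rewrite pnatr_eq0 -lt0n fact_gt0.
have -> : ('C(n, j))%:R = n`!%:R / (j`!%:R * (n - j)`!%:R) :> R.
  by rewrite -(@bin_fact n j)// !natrM mulfK// mulf_neq0.
by field; rewrite !fj.
Qed.

(** The square and the triangle sums differ by at most
    C (E_N(x) E_N(y) - E_N(x + y)), where E_N is a partial sum of exp,
    x = |a| D and y = |b| D; this tends to 0 as exp x exp y = exp (x + y). *)
Lemma cvg_square_sum (q : nat -> R) (a b C D : R) :
  (forall k, `|q k| <= C * D ^+ k) ->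
  square_sum (fun j k => a ^+ j / j`!%:R * (b ^+ k / k`!%:R) * q (j + k)%N) N -
  \sum_(0 <= n < N) (a + b) ^+ n / n`!%:R * q n @[N --> \oo] --> 0.
Proof.
move=> qCD; set F := fun j k => _ * _ * _.
pose x := `|a| * D; pose y := `|b| * D.
pose G j k := x ^+ j / j`!%:R * (y ^+ k / k`!%:R) * C.
have FG j k : `|F j k| <= G j k.
  rewrite /F !normrM !normfV !normr_nat !normrX.
  rewrite (_ : G j k = `|a| ^+ j / j`!%:R * (`|b| ^+ k / k`!%:R) * (C * D ^+ (j + k))).
    by rewrite ler_wpM2l// !mulr_ge0// ?invr_ge0 ?exprn_ge0.
  by rewrite /G /x /y !exprMn exprD; ring.
pose E (z : R) N := series (exp_coeff z) N.
have cE z : E z N @[N --> \oo] --> expR z by exact: is_cvg_series_exp_coeff.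
have sqG N : square_sum G N = E x N * E y N * C.
  rewrite /square_sum /E /series/= !mulr_suml; apply: eq_bigr => j _.
  by rewrite mulr_sumr mulr_suml.
have trG N : triangle_sum G N = E (x + y) N * C.
  by rewrite /G (@triangle_sum_exp (fun=> C)) -mulr_suml.
have cG : square_sum G N - triangle_sum G N @[N --> \oo] --> 0.
  under eq_fun do rewrite sqG trG.
  rewrite -(subrr (expR (x + y) * C)); apply: cvgB; apply: cvgMl => //.
  by rewrite expRD; exact: cvgM.
apply: norm_cvg0; apply: squeeze_cvgr cG; last exact: cvg_cst.
apply: nearW => N; rewrite normr_ge0/= -triangle_sum_exp.
exact: square_subr_triangle_le.
Qed.

End cauchy_product.

(** * Convolution of the Bessel kernels *)

Section bessel_kernel.
Context {R : realType}.
Local Notation leb := (@lebesgue_measure R).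
Implicit Types (m l : nat) (a b s : R).

Definition bkcoeff m b s (k : nat) : R :=
  (- b) ^+ k / k`!%:R * rlker (m + k.*2) s.

(** This is (s / b)^(nu / 2) J_nu(2 sqrt(b s)) with nu = m/2 - 1, for b, s > 0. *)
Definition besselker m b s : R := limn (series (bkcoeff m b s)).

Lemma bkcoeff_bound m b s k : (0 < m)%N ->
  `|bkcoeff m b s k| <= rlker m s * exp_coeff (2 * `|b| * `|s|) k.
Proof.
move=> m0; rewrite /bkcoeff /exp_coeff/=.
have [s0|s0] := ltP 0 s; last by rewrite !rlker_le0// mulr0 mul0r normr0.
rewrite 2!normrM normfV normr_nat normrX normrN (ger0_norm (rlker_ge0 (m + k.*2) s)).
apply: (@le_trans _ _ (`|b| ^+ k / k`!%:R * ((2 * s) ^+ k * rlker m s))).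
  by rewrite ler_wpM2l ?rlker_bound// mulr_ge0 ?invr_ge0// exprn_ge0.
by rewrite (gtr0_norm s0) !exprMn le_eqVlt; apply/orP; left; apply/eqP; ring.
Qed.

Lemma series_exp_coeff_le (x : R) N : 0 <= x -> series (exp_coeff x) N <= expR x.
Proof.
move=> x0; apply: nondecreasing_cvgn_le; last exact: is_cvg_series_exp_coeff.
by apply: nondecreasing_series => n _ _; exact: exp_coeff_ge0.
Qed.

Lemma cvg_besselker m b s : (0 < m)%N ->
  series (bkcoeff m b s) N @[N --> \oo] --> besselker m b s.
Proof.
move=> m0; apply: normed_cvg.
apply: (@series_le_cvg _ _ (fun k => rlker m s * exp_coeff (2 * `|b| * `|s|) k)).
- by move=> k; exact: normr_ge0.
- by move=> k; rewrite mulr_ge0 ?rlker_ge0// exp_coeff_ge0// !mulr_ge0.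
- by move=> k; exact: bkcoeff_bound.
apply: is_cvg_seriesZ.
exact: is_cvg_series_exp_coeff.
Qed.

(** Being uniform in N, this bound provides the integrable majorant for
    convolving term by term. *)
Lemma series_bkcoeff_bound m b s N : (0 < m)%N ->
  `|series (bkcoeff m b s) N| <= rlker m s * expR (2 * `|b| * `|s|).
Proof.
move=> m0; apply: le_trans (ler_norm_sum _ _ _) _.
apply: (@le_trans _ _ (rlker m s * series (exp_coeff (2 * `|b| * `|s|)) N)).
  by rewrite /series/= mulr_sumr; apply: ler_sum => k _; exact: bkcoeff_bound.
by rewrite ler_wpM2l ?rlker_ge0// series_exp_coeff_le// !mulr_ge0.
Qed.

Lemma besselker_le0 m b s : s <= 0 -> besselker m b s = 0.
Proof.
move=> s0; rewrite /besselker (_ : series _ = cst 0) ?lim_cst//.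
apply/funext => N; rewrite /series/= big1// => k _.
by rewrite /bkcoeff rlker_le0 ?mulr0.
Qed.

Lemma besselker0 m s : (0 < m)%N -> besselker m 0 s = rlker m s.
Proof.
move=> m0; apply/cvg_lim => //; rewrite -(cvg_shiftn 1).
rewrite (_ : (fun _ => _) = cst (rlker m s)); first exact: cvg_cst.
apply/funext => N /=; rewrite addn1 /series/= big_nat_recl// big1 ?addr0.
  by rewrite /bkcoeff oppr0 expr0 fact0 divr1 mul1r addn0.
by move=> k _; rewrite /bkcoeff oppr0 expr0n !mul0r.
Qed.

Lemma measurable_bkcoeff_series m b N :
  measurable_fun setT (fun s => series (bkcoeff m b s) N).
Proof.
apply: measurable_sum => k; apply: measurable_funM => //.
exact: measurable_rlker.
Qed.

Lemma measurable_besselker m b : (0 < m)%N -> measurable_fun setT (besselker m b).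
Proof.
move=> m0; apply: (@measurable_fun_cvg _ _ _ _ (fun N s => series (bkcoeff m b s) N)).
  by move=> N; exact: measurable_bkcoeff_series.
by move=> s _; exact: cvg_besselker.
Qed.

Lemma integrable_conv_rlker m l s : (0 < m)%N -> (0 < l)%N ->
  leb.-integrable setT (fun x => (rlker m x * rlker l (s - x))%:E).
Proof.
move=> m0 l0; apply/integrableP; split.
  by apply/measurable_EFinP; exact: measurable_conv_rlker.
rewrite (_ : (\int[_]_x _)%E = (rlker (m + l) s)%:E) ?ltry// -conv_rlker//.
by apply: eq_integral => x _; rewrite gee0_abs// lee_fin mulr_ge0 ?rlker_ge0.
Qed.

Lemma integral_conv_series m l a b s N : (0 < m)%N -> (0 < l)%N ->
  (\int[leb]_x (series (bkcoeff m a x) N * series (bkcoeff l b (s - x)) N)%:E =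
   (square_sum (fun j k => (- a) ^+ j / j`!%:R * ((- b) ^+ k / k`!%:R) *
      rlker (m + l + (j + k).*2) s) N)%:E)%E.
Proof.
move=> m0 l0; pose c (jk : nat * nat) : R :=
  (- a) ^+ jk.1 / jk.1`!%:R * ((- b) ^+ jk.2 / jk.2`!%:R).
pose f (jk : nat * nat) x : \bar R :=
  ((c jk)%:E * (rlker (m + jk.1.*2) x * rlker (l + jk.2.*2) (s - x))%:E)%E.
have intf jk : leb.-integrable setT (f jk).
  by apply: integrableZl => //; apply: integrable_conv_rlker; rewrite ltn_addr.
transitivity (\int[leb]_x (\sum_(0 <= j < N) \sum_(0 <= k < N) f (j, k) x))%E.
  apply: eq_integral => x _; rewrite /series/= mulr_suml -sumEFin.
  apply: eq_bigr => j _; rewrite mulr_sumr -sumEFin; apply: eq_bigr => k _.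
  by rewrite /f -EFinM /c /bkcoeff/=; congr EFin; ring.
rewrite integral_sum//; last first.
  by move=> j; apply: integrable_sum.
rewrite /square_sum -sumEFin; apply: eq_bigr => j _.
rewrite integral_sum// -sumEFin; apply: eq_bigr => k _.
rewrite /f integralZl//; last by apply: integrable_conv_rlker; rewrite ltn_addr.
rewrite conv_rlker; [|by rewrite ltn_addr|by rewrite ltn_addr].
rewrite -EFinM /c/= doubleD.
by congr (_ * rlker _ _)%:E; rewrite addnACA.
Qed.

(** Termwise convolution is legitimate by dominated convergence, the terms being
    supported in [0, s]; the resulting double series is summed along the
    diagonals by the Cauchy product estimate. *)
Lemma conv_besselker m l a b s : (0 < m)%N -> (0 < l)%N ->
  leb.-integrable setT (fun x => (besselker m a x * besselker l b (s - x))%:E) /\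
  (\int[leb]_x (besselker m a x * besselker l b (s - x))%:E =
   (besselker (m + l) (a + b) s)%:E)%E.
Proof.
move=> m0 l0.
pose f_ N x := (series (bkcoeff m a x) N * series (bkcoeff l b (s - x)) N)%:E.
pose C := expR (2 * `|a| * `|s|) * expR (2 * `|b| * `|s|).
pose g x := (C%:E * (rlker m x * rlker l (s - x))%:E)%E.
have C0 : 0 <= C by rewrite mulr_ge0 ?expR_ge0.
have mf_ N : measurable_fun setT (f_ N).
  apply/measurable_EFinP; apply: measurable_funM; first exact: measurable_bkcoeff_series.
  apply: (measurableT_comp (measurable_bkcoeff_series l b N)).
  exact: measurable_funB.
have mf : measurable_fun setT (fun x => (besselker m a x * besselker l b (s - x))%:E).
  apply/measurable_EFinP; apply: measurable_funM; first exact: measurable_besselker.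
  apply: (measurableT_comp (measurable_besselker b l0)); exact: measurable_funB.
have f_f x : f_ N x @[N --> \oo] --> (besselker m a x * besselker l b (s - x))%:E.
  by apply: cvg_EFin; [exact: nearW|apply: cvgM; exact: cvg_besselker].
have f_g x N : (`|f_ N x| <= g x)%E.
  rewrite /f_ /g -EFinM lee_fin normrM.
  have rr0 : 0 <= rlker m x * rlker l (s - x) by rewrite mulr_ge0 ?rlker_ge0.
  have Crr0 : 0 <= C * (rlker m x * rlker l (s - x)) by rewrite mulr_ge0.
  have [x0|x0] := ltP 0 x; last first.
    rewrite (_ : series (bkcoeff m a x) N = 0) ?normr0 ?mul0r //. 
    by rewrite /series/= big1// => k _; rewrite /bkcoeff rlker_le0 ?mulr0.
  have [xs|xs] := ltP x s; last first.
    rewrite (_ : series (bkcoeff l b (s - x)) N = 0) ?normr0 ?mulr0 //.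
    by rewrite /series/= big1// => k _; rewrite /bkcoeff rlker_le0 ?mulr0// subr_le0.
  have sx0 : 0 < s - x by rewrite subr_gt0.
  apply: le_trans (ler_pM _ _ (series_bkcoeff_bound _ _ _ m0)
    (series_bkcoeff_bound _ _ _ l0)) _ => //.
  rewrite [leLHS](_ : _ = expR (2 * `|a| * `|x|) * expR (2 * `|b| * `|s - x|) *
     (rlker m x * rlker l (s - x))); last by ring.
  rewrite ler_wpM2r// /C.
  rewrite ler_pM ?expR_ge0// ler_expR ler_wpM2l ?mulr_ge0//.
    by rewrite (gtr0_norm x0) (gtr0_norm (lt_trans x0 xs)) ltW.
  rewrite (gtr0_norm sx0) (gtr0_norm (lt_trans x0 xs)).
  by rewrite gerBl ltW.
have ig : leb.-integrable setT g.
  by apply: integrableZl => //; exact: integrable_conv_rlker.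
pose f x := (besselker m a x * besselker l b (s - x))%:E.
have aef : {ae leb, forall x, setT x -> f_ ^~ x @ \oo --> f x}.
  by apply: aeW => x _; exact: f_f.
have aeg : {ae leb, forall x N, setT x -> (`|f_ N x| <= g x)%E}.
  by apply: aeW => x N _; exact: f_g.
have [fi _ fcv] := @dominated_convergence _ (measurableTypeR R) R leb setT
  measurableT f_ f g mf_ mf aef ig aeg.
split => //.
have : (\int[leb]_x f_ N x)%E @[N --> \oo] --> (besselker (m + l) (a + b) s)%:E.
  under eq_fun do rewrite integral_conv_series//.
  apply: cvg_EFin; first exact: nearW.
  set q := fun k => rlker (m + l + k.*2) s.
  have qb k : `|q k| <= rlker (m + l) s * (2 * `|s|) ^+ k.
    rewrite ger0_norm ?rlker_ge0// mulrC.
    apply: le_trans (rlker_bound _ _ _) _; first by rewrite ltn_addr.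
    have [s0|s0] := ltP 0 s; last by rewrite (rlker_le0 _ s0) !mulr0.
    by rewrite (gtr0_norm s0).
  have H := cvg_square_sum (- a) (- b) qb.
  have H2 : \sum_(0 <= n < N) (- a + - b) ^+ n / n`!%:R * q n @[N --> \oo] -->
      besselker (m + l) (a + b) s.
    by rewrite -opprD; apply: cvg_besselker; rewrite ltn_addr.
  rewrite -[besselker _ _ _]add0r; apply: cvg_trans (cvgD H H2).
  by apply: near_eq_cvg; apply: nearW => N /=; rewrite [in LHS]fctE subrK.
by move=> H; apply: (cvg_unique _ fcv H).
Qed.

End bessel_kernel.

(** * The kernels of the spheres *)

Section spherical_kernel.
Context {R : realType}.
Local Notation leb := (@lebesgue_measure R).

(** The h_{n,b} of the introduction. For b = |w|^2 it is the density of the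
    image under z |-> |z|^2 of the signed measure cos(w.z) dz on
    R^n; equivalently the Fourier transform of the surface measure of the sphere
    of radius sqrt s, divided by 2 sqrt s. *)
Definition sphker (n : nat) (b s : R) : R :=
  pi `^ (n%:R / 2) * besselker n (b / 4) s.

Lemma measurable_sphker n b : (0 < n)%N -> measurable_fun setT (sphker n b).
Proof. by move=> n0; apply: measurable_funM => //; exact: measurable_besselker. Qed.

Lemma sphker_le0 n b s : s <= 0 -> sphker n b s = 0.
Proof. by move=> s0; rewrite /sphker besselker_le0 ?mulr0. Qed.

Lemma sphker0 n s : (0 < n)%N -> sphker n 0 s = pi `^ (n%:R / 2) * rlker n s.
Proof. by move=> n0; rewrite /sphker mul0r besselker0. Qed.

Lemma sphker0_ge0 n s : (0 < n)%N -> 0 <= sphker n 0 s.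
Proof. by move=> n0; rewrite sphker0// mulr_ge0 ?powR_ge0 ?rlker_ge0. Qed.

Lemma conv_sphker (m l : nat) (a b s : R) : (0 < m)%N -> (0 < l)%N ->
  leb.-integrable setT (fun x => (sphker m a x * sphker l b (s - x))%:E) /\
  (\int[leb]_x (sphker m a x * sphker l b (s - x))%:E =
   (sphker (m + l) (a + b) s)%:E)%E.
Proof.
move=> m0 l0; have [ic ec] := conv_besselker (a / 4) (b / 4) s m0 l0.
have E : (fun x => (sphker m a x * sphker l b (s - x))%:E) =
    (fun x => (pi `^ (m%:R / 2) * pi `^ (l%:R / 2))%:E *
     (besselker m (a / 4) x * besselker l (b / 4) (s - x))%:E)%E.
  by apply/funext => x; rewrite -EFinM /sphker mulrACA.
rewrite E; split; first exact: integrableZl.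
rewrite integralZl// ec -EFinM /sphker -mulrDl; congr (_ * _)%:E.
by rewrite natrD [in RHS]mulrDl powRD// (gt_eqF (pi_gt0 _)) implybT.
Qed.

(** The duplication formula at half-integers; it turns the Bessel series of
    order -1/2 into the cosine series. *)
Lemma Gamma_half_odd (k : nat) :
  Gamma ((1 + k.*2)%:R / 2) = k.*2`!%:R / (4 ^+ k * k`!%:R) * Num.sqrt pi :> R.
Proof.
elim: k => [|k ih]; first by rewrite Gamma_half1 fact0 expr0 mul1r divr1 mul1r.
have -> : (1 + k.+1.*2)%:R / 2 = (1 + k.*2)%:R / 2 + 1 :> R.
  by rewrite doubleS !natrD -[k.*2.+2]addn2 natrD; field.
have k2E : k.*2%:R = 2 * k%:R :> R by rewrite -mul2n natrM.
rewrite Gamma_half_succ// ih doubleS 3!factS !natrM exprS.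
rewrite -(natr1 k.*2.+1) -(natr1 k.*2) -(natr1 k) k2E.
have k0 : 0 <= k%:R :> R by [].
field.
by rewrite !lt0r_neq0 ?exprn_gt0 ?ltr0n ?fact_gt0 ?ltr_wpDl.
Qed.

Lemma sphker1 (w s : R) : 0 < s ->
  sphker 1 (w ^+ 2) s = cos (w * Num.sqrt s) / Num.sqrt s.
Proof.
move=> s0; have rs0 : 0 < Num.sqrt s by rewrite sqrtr_gt0.
have rpi0 : 0 < Num.sqrt pi :> R by rewrite sqrtr_gt0 pi_gt0.
have -> : sphker 1 (w ^+ 2) s = Num.sqrt pi * besselker 1 (w ^+ 2 / 4) s.
  by rewrite /sphker powR_half ?pi_ge0// expr1.
apply: (mulfI (lt0r_neq0 rs0)); rewrite [RHS]mulrC mulfVK ?lt0r_neq0//.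
have H : series (cos_coeff' (w * Num.sqrt s)) N @[N --> \oo] -->
    Num.sqrt s * (Num.sqrt pi * besselker 1 (w ^+ 2 / 4) s).
  rewrite mulrA; apply: cvg_trans (cvgM (cvg_cst (Num.sqrt s * Num.sqrt pi))
    (@cvg_besselker R 1 (w ^+ 2 / 4) s isT)).
  apply: near_eq_cvg; apply: nearW => N.
  rewrite /series/= [in LHS]mulr_sumr; apply: eq_bigr => k _.
  rewrite /bkcoeff /rlker /ppow s0 Gamma_half_odd /cos_coeff'.
  have -> : s `^ ((1 + k.*2)%:R / 2 - 1) = s ^+ k / Num.sqrt s.
    rewrite powRB ?(gt_eqF s0) ?implybT// powRr1 ?ltW// powR_half ?ltW//.
    rewrite add1n exprS -mul2n exprM sqr_sqrtr ?ltW//.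
    rewrite -[X in _ / X = _](sqr_sqrtr (ltW s0)).
    by field; exact: lt0r_neq0.
  have -> : (w * Num.sqrt s) ^+ k.*2 = (w ^+ 2) ^+ k * s ^+ k.
    by rewrite -mul2n exprM [(w * _) ^+ 2]exprMn sqr_sqrtr ?ltW// exprMn.
  rewrite -exprnP.
  have -> : (- (w ^+ 2 / 4)) ^+ k = (-1) ^+ k * (w ^+ 2) ^+ k / 4 ^+ k.
    by rewrite [in LHS]exprNn expr_div_n mulrA.
  by field; rewrite !lt0r_neq0 ?exprn_gt0 ?ltr0n ?fact_gt0.
by rewrite -(cvg_lim (@norm_hausdorff _ _) H) (cvg_lim (@norm_hausdorff _ _) (@cvg_cos_coeff' _ _)).
Qed.

Lemma sphker10 (s : R) : 0 < s -> sphker 1 0 s = (Num.sqrt s)^-1.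
Proof. by move=> s0; have := sphker1 0 s0; rewrite expr0n/= mul0r cos0 mul1r. Qed.

(** The Fourier transform of a positive measure is largest at 0. Here this
    follows from the convolution identity: all of b is put on a first factor,
    by induction, and the other factor is h_{1,0} >= 0. In dimension 1 it is
    |cos| <= 1. *)
Lemma normr_sphker_le (n : nat) (b s : R) : (0 < n)%N -> 0 <= b ->
  `|sphker n b s| <= sphker n 0 s.
Proof.
case: n => // n _ b0.
have one c t : 0 <= c -> `|sphker 1 c t| <= sphker 1 0 t.
  move=> c0; have [t0|t0] := ltP 0 t; last by rewrite !sphker_le0// normr0.
  rewrite sphker10// -(sqr_sqrtr c0) sphker1// normrM.
  rewrite [X in _ * X <= _]ger0_norm ?invr_ge0 ?sqrtr_ge0//.
  by rewrite ler_piMl ?invr_ge0 ?sqrtr_ge0// ler_norml cos_geN1 cos_le1.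
elim: n b b0 s => [|n ih] b b0 s; first exact: one.
rewrite -addn1.
have [ic ec] := @conv_sphker n.+1 1 b 0 s isT isT.
have [ic0 ec0] := @conv_sphker n.+1 1 0 0 s isT isT.
rewrite addr0 in ec; rewrite addr0 in ec0.
rewrite -lee_fin -ec0 -abse_EFin -ec.
apply: le_trans (le_abse_integral _ _ _) _ => //.
  by case/integrableP: ic.
apply: ge0_le_integral => //.
- by apply: measurableT_comp => //; case/integrableP: ic.
- by case/integrableP: ic0.
- move=> x _; rewrite lee_fin.
  have h1 := @sphker0_ge0 1 (s - x) isT.
  rewrite normrM.
  rewrite [X in _ * X <= _]ger0_norm; last exact: h1.
  apply: ler_wpM2r; first exact: h1.
  exact: ih b0 x.
Qed.

End spherical_kernel.

(** * Integrals of radial waves *)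

Section radial_integrals.
Context {R : realType}.
Local Notation leb := (@lebesgue_measure R).

(** What keeps the integrands of the induction nonnegative. *)
Lemma phase_comb_ge0 (A B c x y : R) : `|B| <= A -> `|c| <= 1 -> `|y| <= x ->
  0 <= A * x + B * c * y.
Proof.
move=> BA c1 yx.
have Bc : `|B * c| <= A by rewrite normrM -[A]mulr1; exact: ler_pM.
have : `|B * c * y| <= A * x by rewrite normrM; exact: ler_pM.
by rewrite ler_norml => /andP[h _]; rewrite addrC -lerBlDr sub0r.
Qed.

Lemma normr_cos_le1 (x : R) : `|cos x| <= 1.
Proof. by rewrite ler_norml cos_geN1 cos_le1. Qed.

Lemma ge0_integral_fold (f : R -> \bar R) :
  measurable_fun setT f -> (forall x, 0 <= f x)%E ->
  (\int[leb]_x f x = \int[leb]_(x in `]0%R, +oo[) (f x + f (- x)%R))%E.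
Proof.
move=> mf f0.
have mfN : measurable_fun setT (fun x : R => f (- x)) by exact: measurableT_comp.
rewrite ge0_integralD//; last 2 first.
- exact: measurable_funTS.
- exact: measurable_funTS.
rewrite -(setUv `]-oo, 0%R]) ge0_integral_setU//=; last 3 first.
- exact: measurableC.
- by rewrite setUv.
- exact/disj_setPCl.
rewrite setCitvl addeC; congr (_ + _)%E.
rewrite [RHS]integral_itv_obnd_cbnd; last exact: measurable_funTS.
rewrite (ge0_integration_by_substitution0 mfN)//.
by apply: eq_integral => x _; rewrite opprK.
Qed.

(** The case of dimension 1: adding the values at x and - x leaves
    2 cos theta cos (w x), and x^2 = s. *)
Lemma integral_sqr_cos (K : R -> R) (A B theta w : R) :
  measurable_fun setT K -> (forall x, 0 <= K x) -> `|B| <= A ->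
  (\int[leb]_x (K (x ^+ 2) * (A + B * cos (theta + w * x)))%:E =
   \int[leb]_s (K s * (A * sphker 1 0 s + B * cos theta * sphker 1 (w ^+ 2) s))%:E)%E.
Proof.
move=> mK K0 BA.
have mcos : measurable_fun setT (fun x : R => cos (theta + w * x)).
  apply: measurableT_comp; last by apply: measurable_funD => //; exact: measurable_funM.
  apply: continuous_measurable_fun; exact: continuous_cos.
rewrite ge0_integral_fold; last 2 first.
- apply/measurable_EFinP; apply: measurable_funM; first exact: measurableT_comp.
  by apply: measurable_funD => //; exact: measurable_funM.
- move=> x; rewrite lee_fin mulr_ge0//.
  have := @phase_comb_ge0 A B _ 1 1 BA (normr_cos_le1 (theta + w * x)).
  by rewrite !mulr1 normr1; apply.
pose f s := (K s * (A * sphker 1 0 s + B * cos theta * sphker 1 (w ^+ 2) s))%:E.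
have f0 s : (0 <= f s)%E.
  rewrite lee_fin mulr_ge0// phase_comb_ge0// ?normr_cos_le1//.
  by rewrite normr_sphker_le ?sqr_ge0.
have mf : measurable_fun setT f.
  apply/measurable_EFinP; apply: measurable_funM => //.
  by apply: measurable_funD; apply: measurable_funM => //; exact: measurable_sphker.
transitivity (\int[leb]_(s in `]0%R, +oo[) f s)%E; last first.
  rewrite integral_mkcond; apply: eq_integral => s _.
  rewrite patchE mem_setE in_itv/= andbT /f; case: ltP => // s0.
  by rewrite !sphker_le0// !mulr0 addr0 mulr0.
rewrite [RHS]ge0_integral_sqr//; apply: eq_integral => r; rewrite inE/= in_itv/= andbT => r0.
rewrite -!EFinM -EFinD; congr EFin.
have sr0 : 0 < r ^+ 2 by rewrite exprn_gt0.
have -> : sphker 1 0 (r ^+ 2) = r^-1.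
  by rewrite sphker10// sqrtr_sqr gtr0_norm.
rewrite sphker1// sqrtr_sqr gtr0_norm// sqrrN mulrN cosB cosD.
by field; exact: lt0r_neq0.
Qed.

End radial_integrals.

Section tuples.
Context {R : realType}.
Local Notation leb := (@lebesgue_measure R).

Lemma dotvE n (u v : 'cV[R]_n) : dotv u v = \sum_i u i 0 * v i 0.
Proof. by rewrite /dotv mxE; apply: eq_bigr => i _; rewrite mxE. Qed.

Lemma dotv_ge0 n (u : 'cV[R]_n) : 0 <= dotv u u.
Proof. by rewrite dotvE; apply: sumr_ge0 => i _; rewrite -expr2 sqr_ge0. Qed.

Lemma dotv_cons n (w : 'cV[R]_n.+1) (x : R) (z : n.-tuple R) :
  dotv w (colv (cons_tup (x, z))) =
  w ord0 0 * x + dotv (\col_i w (lift ord0 i) 0) (colv z).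
Proof.
rewrite !dotvE big_ord_recl !mxE; congr (_ * _ + _).
by apply: eq_bigr => i _; rewrite !mxE tnthS.
Qed.

Lemma sqr_dotv_cons n (x : R) (z : n.-tuple R) :
  dotv (colv (cons_tup (x, z))) (colv (cons_tup (x, z))) =
  x ^+ 2 + dotv (colv z) (colv z).
Proof.
rewrite !dotvE big_ord_recl !mxE; congr (_ + _).
by apply: eq_bigr => i _; rewrite !mxE !tnthS.
Qed.

Lemma dotv_recl n (w : 'cV[R]_n.+1) :
  dotv w w = w ord0 0 ^+ 2 +
    dotv (\col_i w (lift ord0 i) 0) (\col_i w (lift ord0 i) 0).
Proof.
rewrite !dotvE big_ord_recl; congr (_ + _).
by apply: eq_bigr => i _; rewrite !mxE.
Qed.

Lemma measurable_dotv n (w : 'cV[R]_n) :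
  measurable_fun setT (fun z : n.-tuple R => dotv w (colv z)).
Proof.
under eq_fun do rewrite dotvE.
apply: measurable_sum => i; apply: measurable_funM => //.
under eq_fun do rewrite mxE.
exact: measurable_tnth.
Qed.

Lemma measurable_sqr_dotv n :
  measurable_fun setT (fun z : n.-tuple R => dotv (colv z) (colv z)).
Proof.
under eq_fun do rewrite dotvE.
apply: measurable_sum => i; apply: measurable_funM;
  under eq_fun do rewrite mxE; exact: measurable_tnth.
Qed.

Lemma ge0_integral_lebesgue_tupleS n (f : n.+1.-tuple R -> \bar R) :
  measurable_fun setT f -> (forall z, 0 <= f z)%E ->
  (\int[lebesgue_tuple R n.+1]_z f z =
   \int[leb]_x \int[lebesgue_tuple R n]_z f (cons_tup (x, z)))%E.
Proof.
move=> mf f0; rewrite /= /lebesgue_step.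
transitivity (\int[leb \x lebesgue_tuple R n]_p f (cons_tup p))%E.
  have f0' : {in [set: n.+1.-tuple R], forall z, (0 <= f z)%E} by move=> z _.
  have mc : measurable_fun [set: measurableTypeR R * n.-tuple R] (@cons_tup R n).
    exact: measurable_cons_tup.
  exact: (@ge0_integral_pushforward _ _ _ _ R _ mc
    (leb \x lebesgue_tuple R n)%E setT f measurableT mf f0').
rewrite fubini_tonelli1//.
by apply: measurableT_comp => //; exact: measurable_cons_tup.
Qed.

End tuples.

Section fourier_radial.
Context {R : realType}.
Local Notation leb := (@lebesgue_measure R).

Definition radial_wave (n : nat) (G : R -> R) (A B theta : R) (w : 'cV[R]_n)
    (z : n.-tuple R) : R :=
  G (dotv (colv z) (colv z)) * (A + B * cos (theta + dotv w (colv z))).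

Lemma measurable_radial_wave n G A B theta (w : 'cV[R]_n) :
  measurable_fun setT G -> measurable_fun setT (radial_wave G A B theta w).
Proof.
move=> mG; apply: measurable_funM.
  by apply: (measurableT_comp mG); exact: measurable_sqr_dotv.
apply: measurable_funD => //; apply: measurable_funM; first by [].
apply: measurableT_comp; first by apply: continuous_measurable_fun; exact: continuous_cos.
by apply: measurable_funD => //; exact: measurable_dotv.
Qed.

Lemma radial_wave_ge0 n G A B theta (w : 'cV[R]_n) z :
  (forall s, 0 <= G s) -> `|B| <= A -> 0 <= radial_wave G A B theta w z.
Proof.
move=> G0 BA; rewrite mulr_ge0//.
have := @phase_comb_ge0 R A B _ 1 1 BA (normr_cos_le1 (theta + dotv w (colv z))).
by rewrite !mulr1 normr1; apply.
Qed.

Definition radial_dens (n : nat) (A B theta b s : R) : R :=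
  A * sphker n 0 s + B * cos theta * sphker n b s.

Lemma radial_dens_ge0 n A B theta b s : (0 < n)%N -> 0 <= b -> `|B| <= A ->
  0 <= radial_dens n A B theta b s.
Proof.
move=> n0 b0 BA; apply: phase_comb_ge0 => //; first exact: normr_cos_le1.
exact: normr_sphker_le.
Qed.

Lemma integral_conv_radial_dens n (G A B theta a b r : R) : (0 < n)%N ->
  0 <= a -> 0 <= b -> `|B| <= A -> 0 <= G ->
  (\int[leb]_q (G * (A * (sphker 1 0 q * sphker n 0 (r - q)) +
      B * cos theta * (sphker 1 a q * sphker n b (r - q))))%:E =
   (G * radial_dens n.+1 A B theta (a + b) r)%:E)%E.
Proof.
move=> n0 a0 b0 BA G0.
have [i0 e0] := @conv_sphker R 1 n 0 0 r isT n0.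
have [i1 e1] := @conv_sphker R 1 n a b r isT n0.
under eq_integral do rewrite EFinM EFinD (EFinM A) (EFinM (B * cos theta)).
rewrite integralZl//; last by apply: integrableD => //; exact: integrableZl.
rewrite integralD//; try exact: integrableZl.
by rewrite !integralZl// e0 e1 addr0 -!EFinM.
Qed.

(** The induction on the dimension peels off the first coordinate x. The phase
    theta absorbs w_1 x, and the image of dx under x^2 is again given by a
    kernel, so that the densities convolve. Adding the constant A >= |B| makes
    every integrand nonnegative, as Tonelli requires. *)
Lemma integral_radial_wave n (G : R -> R) (A B theta : R) (w : 'cV[R]_n.+1) :
  measurable_fun setT G -> (forall s, 0 <= G s) -> `|B| <= A ->
  (\int[lebesgue_tuple R n.+1]_z (radial_wave G A B theta w z)%:E =
   \int[leb]_s (G s * radial_dens n.+1 A B theta (dotv w w) s)%:E)%E.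
Proof.
elim: n G A B theta w => [|n ih] G A B theta w mG G0 BA.
  rewrite ge0_integral_lebesgue_tupleS; last 2 first.
  - by apply/measurable_EFinP; exact: measurable_radial_wave.
  - by move=> z; rewrite lee_fin radial_wave_ge0.
  rewrite dotv_recl [X in _ + X]dotvE big_ord0 addr0 -integral_sqr_cos//.
  apply: eq_integral => x _ /=; rewrite integral_dirac//; last first.
    apply/measurable_EFinP; apply: measurableT_comp; first exact: measurable_radial_wave.
    by apply: measurableT_comp; [exact: measurable_cons_tup|exact: measurable_pair1].
  rewrite diracT mul1e /radial_wave sqr_dotv_cons dotv_cons.
  by rewrite [X in x ^+ 2 + X]dotvE [X in _ * x + X]dotvE !big_ord0 !addr0.
rewrite ge0_integral_lebesgue_tupleS; last 2 first.
- by apply/measurable_EFinP; exact: measurable_radial_wave.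
- by move=> z; rewrite lee_fin radial_wave_ge0.
set w' := \col_i w (lift ord0 i) 0.
set x0 := w ord0 0.
have w0 : 0 <= dotv w' w' := dotv_ge0 w'.
have mGD (c : R) : measurable_fun setT (fun s : R => G (c + s)).
  by apply: measurableT_comp => //; exact: measurable_funD.
transitivity (\int[leb]_x \int[leb]_s
    (G (x ^+ 2 + s) * radial_dens n.+1 A B (theta + x0 * x) (dotv w' w') s)%:E)%E.
  apply: eq_integral => x _.
  rewrite -(ih (fun s => G (x ^+ 2 + s)))//.
  apply: eq_integral => z _.
  by rewrite /radial_wave sqr_dotv_cons dotv_cons addrA.
rewrite (@tonelli R _ _ _ _ leb leb (fun x s =>
  (G (x ^+ 2 + s) * radial_dens n.+1 A B (theta + x0 * x) (dotv w' w') s)%:E)); last 2 first.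
- apply/measurable_EFinP; apply: measurable_funM.
    apply: (measurableT_comp mG); apply: measurable_funD => //.
    exact: measurable_funX.
  rewrite /radial_dens; apply: measurable_funD.
    by apply: measurable_funM => //; apply: measurableT_comp => //; exact: measurable_sphker.
  apply: measurable_funM.
    apply: measurable_funM => //; apply: measurableT_comp.
      by apply: continuous_measurable_fun; exact: continuous_cos.
    by apply: measurable_funD => //; exact: measurable_funM.
  by apply: measurableT_comp => //; exact: measurable_sphker.
- by move=> x s; rewrite lee_fin mulr_ge0// radial_dens_ge0.
(* For fixed s the integral over x is again of dimension 1, the constants A and
   B being multiplied by the kernels at s. *)
pose h0 (s : R) := sphker n.+1 0 s.
pose hw (s : R) := sphker n.+1 (dotv w' w') s.
have hh s : `|B * hw s| <= A * h0 s.
  by rewrite normrM; apply: ler_pM => //; exact: normr_sphker_le.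
transitivity (\int[leb]_s \int[leb]_q (G (q + s) *
    (A * (sphker 1 0 q * h0 s) + B * cos theta * (sphker 1 (x0 ^+ 2) q * hw s)))%:E)%E.
  apply: eq_integral => s _.
  transitivity (\int[leb]_x (G (x ^+ 2 + s) *
      (A * h0 s + B * hw s * cos (theta + x0 * x)))%:E)%E.
    by apply: eq_integral => x _; rewrite /radial_dens /h0 /hw mulrAC.
  rewrite (@integral_sqr_cos R (fun q => G (q + s)))//; last first.
    by apply: measurableT_comp => //; exact: measurable_funD.
  apply: eq_integral => q _; congr (_ * _)%:E.
  move: (sphker 1 0 q) (sphker 1 (x0 ^+ 2) q) (h0 s) (hw s) => k1 k2 k3 k4; ring.
pose f (q s r : R) := (G r * (A * (sphker 1 0 q * h0 s) +
   B * cos theta * (sphker 1 (x0 ^+ 2) q * hw s)))%:E.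
have f0 q s r : (0 <= f q s r)%E.
  rewrite lee_fin mulr_ge0// phase_comb_ge0// ?normr_cos_le1//.
  rewrite normrM; apply: ler_pM => //; apply: normr_sphker_le => //; exact: sqr_ge0.
have mf d' (S : measurableType d') (q s r : S -> R) : measurable_fun setT q ->
    measurable_fun setT s -> measurable_fun setT r ->
    measurable_fun setT (fun x => f (q x) (s x) (r x)).
  move=> mq ms mr; apply/measurable_EFinP; apply: measurable_funM.
    exact: measurableT_comp.
  apply: measurable_funD; apply: measurable_funM => //; apply: measurable_funM;
    apply: measurableT_comp => //; exact: measurable_sphker.
transitivity (\int[leb]_s \int[leb]_q f q s (q + s)%R)%E; first by [].
rewrite (@tonelli R _ _ _ _ leb leb (fun s q => f q s (q + s))); last 2 first.
- by apply: mf => //; exact: measurable_funD.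
- by move=> s q; exact: f0.
transitivity (\int[leb]_q \int[leb]_r f q (r - q)%R r)%E.
  apply: eq_integral => q _; rewrite [LHS](ge0_integral_translate (- q)).
  - by apply: eq_integral => r _; rewrite addrCA subrr addr0.
  - by apply: (mf _ R (fun=> q) id (fun s => q + s)) => //; exact: measurable_funD.
  - by move=> s; exact: f0.
rewrite (@tonelli R _ _ _ _ leb leb (fun q r => f q (r - q) r)); last 2 first.
- by apply: mf => //; exact: measurable_funB.
- by move=> s q; exact: f0.
apply: eq_integral => r _; rewrite dotv_recl -integral_conv_radial_dens//.
exact: sqr_ge0.
Qed.

End fourier_radial.

(** * The Bessel integral *)

Section bessel_transform.
Context {R : realType}.
Local Notation leb := (@lebesgue_measure R).

Lemma powR_half_sub1 (x : R) (n : nat) : 0 < x ->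
  (x ^+ 2) `^ (n%:R / 2 - 1) = x ^+ n / x ^+ 2.
Proof.
move=> x0; rewrite powRB ?powRr1 ?sqr_ge0 ?powR_half_sqr ?(ltW x0)//.
by rewrite sqrf_eq0 (gt_eqF x0) implybT.
Qed.

(** Term by term, since (r u / 2)^(nu + 2 k) = (r u / 2)^nu (r^2 u^2 / 4)^k. *)
Lemma besselJ_besselker (n : nat) (r u : R) : (0 < n)%N -> 0 < r -> 0 < u ->
  r `^ (n%:R / 2) * besselJ ((n%:R - 2) / 2) (r * u) =
  (u / 2) `^ ((n%:R - 2) / 2) * (r * besselker n (u ^+ 2 / 4) (r ^+ 2)).
Proof.
move=> n0 r0 u0; set nu := (n%:R - 2) / 2.
have p0 : 0 < r `^ (n%:R / 2) by exact: powR_gt0.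
apply: (mulfI (lt0r_neq0 (_ : 0 < (r `^ (n%:R / 2))^-1))); rewrite ?invr_gt0//.
rewrite mulKf ?lt0r_neq0// [RHS]mulrA [RHS]mulrA.
suff H : series (fun k : nat => (-1) ^+ k / (k`!%:R * Gamma (nu + k%:R + 1)) *
    (r * u / 2) `^ (nu + 2 * k%:R)) N @[N --> \oo] -->
    (r `^ (n%:R / 2))^-1 * (u / 2) `^ nu * r * besselker n (u ^+ 2 / 4) (r ^+ 2).
  by move/cvg_lim: H => <-.
apply: cvg_trans (cvgM (cvg_cst ((r `^ (n%:R / 2))^-1 * (u / 2) `^ nu * r))
  (@cvg_besselker R n (u ^+ 2 / 4) (r ^+ 2) n0)).
apply: near_eq_cvg; apply: nearW => N.
rewrite /series/= [in LHS]mulr_sumr; apply: eq_bigr => k _.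
rewrite /bkcoeff /rlker /ppow exprn_gt0// powR_half_sub1//.
have -> : nu + k%:R + 1 = (n + k.*2)%:R / 2.
  by rewrite /nu -mul2n natrD natrM; field.
have xE : (r * u / 2) `^ (nu + 2 * k%:R) =
    r `^ (n%:R / 2) / r * (u / 2) `^ nu * ((r ^+ 2) ^+ k * (u ^+ 2 / 4) ^+ k).
  have -> : 2 * k%:R = (2 * k)%:R :> R by rewrite natrM.
  have ru0 : 0 < r * u / 2 by rewrite divr_gt0// mulr_gt0.
  rewrite powRD ?(gt_eqF ru0) ?implybT// powR_mulrn ?(ltW ru0)// exprM -mulrA.
  rewrite [X in X * _]powRM ?divr_ge0 ?(ltW r0) ?(ltW u0)//.
  have -> : r `^ nu = r `^ (n%:R / 2) / r.
    rewrite /nu mulrBl divff ?pnatr_eq0// powRB ?(gt_eqF r0) ?implybT//.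
    by rewrite powRr1 ?ltW.
  rewrite -[in RHS]exprMn; congr (_ * _ ^+ _); by field.
have pp : r ^+ n = r `^ (n%:R / 2) * r `^ (n%:R / 2).
  rewrite -powRD ?(gt_eqF r0) ?implybT// -powR_mulrn ?(ltW r0)//; congr (_ `^ _).
  by field.
have f0 : k`!%:R != 0 :> R by rewrite pnatr_eq0 -lt0n fact_gt0.
rewrite xE [in LHS]exprNn exprD -mul2n exprM pp; move: (r `^ (n%:R / 2)) p0 => p p0.
move: ((u / 2) `^ nu) ((u ^+ 2 / 4) ^+ k) => v y.
have := @Gamma_half_gt0 R (n + 2 * k) (ltn_addr _ n0).
move: (Gamma _) ((r ^+ 2) ^+ k) ((-1) ^+ k) => Ga rk s Ga0.
move: (k`!%:R) f0 => fk f0; field.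
by rewrite f0 !lt0r_neq0.
Qed.

Lemma integral_sqr (f : R -> \bar R) : measurable_fun setT f ->
  (\int[leb]_(s in `]0%R, +oo[) f s =
   \int[leb]_(r in `]0%R, +oo[) (f (r ^+ 2)%R * (2 * r)%:E))%E.
Proof.
move=> mf; rewrite integralE [RHS]integralE.
congr (_ - _)%E.
  rewrite ge0_integral_sqr//; last exact: measurable_funepos.
  apply: eq_integral => r; rewrite inE/= in_itv/= andbT => r0.
  by rewrite !funeposE muleC maxe_pMr ?mule0 ?lee_fin ?mulr_ge0 ?(ltW r0)// muleC.
rewrite ge0_integral_sqr//; last exact: measurable_funeneg.
apply: eq_integral => r; rewrite inE/= in_itv/= andbT => r0.
rewrite !funenegE muleC maxe_pMr ?mule0 ?lee_fin ?mulr_ge0 ?(ltW r0)//.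
by rewrite muleN muleC.
Qed.

Lemma integrable_sqr (f : R -> \bar R) : measurable_fun setT f ->
  leb.-integrable `]0, +oo[ f ->
  leb.-integrable `]0, +oo[ (fun r => f (r ^+ 2)%R * (2 * r)%:E)%E.
Proof.
move=> mf /integrableP[_ fi]; apply/integrableP; split.
  apply: measurable_funTS; apply: emeasurable_funM.
    by apply: (measurableT_comp mf); exact: measurable_funX.
  by apply/measurable_EFinP; exact: measurable_funM.
apply: le_lt_trans fi; rewrite [leRHS]ge0_integral_sqr//; last exact: measurableT_comp.
rewrite le_eqVlt; apply/orP; left; apply/eqP/eq_integral => r.
rewrite inE/= in_itv/= andbT => r0.
by rewrite abseM [X in (_ * X)%E]gee0_abs// lee_fin mulr_ge0// ltW.
Qed.

Definition bessel_mean (n : nat) (G : R -> R) (b : R) : R :=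
  \int[leb]_s (G s * sphker n b s).

Lemma integrable_sphker (n : nat) (G : R -> R) (b : R) : (0 < n)%N -> 0 <= b ->
  measurable_fun setT G -> (forall s, 0 <= G s) ->
  leb.-integrable setT (fun s => (G s * sphker n 0 s)%:E) ->
  leb.-integrable setT (fun s => (G s * sphker n b s)%:E).
Proof.
move=> n0 b0 mG G0; apply: le_integrable => //.
  apply/measurable_EFinP; apply: measurable_funM => //; exact: measurable_sphker.
move=> s _; rewrite lee_fin normrM (ger0_norm (G0 s)).
rewrite [leRHS]ger0_norm; last by apply: mulr_ge0; [exact: G0|exact: sphker0_ge0].
by apply: ler_wpM2l; [exact: G0|exact: normr_sphker_le].
Qed.

(** The substitution s = r^2 in the Bessel integral. The generator is extended
    by 0 to the negative half-line, where it is arbitrary. *)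
Lemma ell_phi_rhsE (n : nat) (g : R -> R) (u : R)
    (G := g \_ (`[0, +oo[ : set R)) : (0 < n)%N -> 0 < u ->
  measurable_fun setT G -> (forall s, 0 <= G s) ->
  leb.-integrable setT (fun s => (G s * sphker n 0 s)%:E) ->
  ell_phi_rhs n g u = ell_const n g * bessel_mean n G (u ^+ 2).
Proof.
move=> n0 u0 mG G0 iG0; set b := u ^+ 2.
have iG : leb.-integrable setT (fun s => (G s * sphker n b s)%:E).
  by apply: integrable_sphker => //; exact: sqr_ge0.
pose nu : R := (n%:R - 2) / 2.
pose kappa := (u / 2) `^ nu / (2 * pi `^ (n%:R / 2)).
pose q s := (G s * sphker n b s)%:E.
have mq : measurable_fun setT q by case/integrableP: iG.
have q0 s : s <= 0 -> q s = 0%E by move=> s0; rewrite /q sphker_le0 ?mulr0.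
have qE : (\int[leb]_s q s = \int[leb]_(s in `]0%R, +oo[) q s)%E.
  rewrite [RHS]integral_mkcond; apply: eq_integral => s _.
  by rewrite patchE mem_setE in_itv/= andbT; case: ltP => // /q0.
have FE : (\int[leb]_(r in `[0%R, +oo[)
      (r `^ (n%:R / 2) * besselJ nu (r * u) * g (r ^+ 2))%:E =
    \int[leb]_(r in `]0%R, +oo[) (kappa%:E * (q (r ^+ 2)%R * (2 * r)%:E)))%E.
  rewrite integral_mkcond [RHS]integral_mkcond; apply: eq_integral => r _.
  rewrite !patchE !mem_setE !in_itv/= !andbT.
  (* At r = 0 both integrands vanish, although J_nu is singular there for
     n = 1. *)
  case: (ltgtP 0 r) => //= [r0|<-]; last first.
    by rewrite powR0 ?mul0r// mulf_neq0 ?invr_eq0 ?pnatr_eq0// -lt0n.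
  rewrite besselJ_besselker// /q /sphker /b /kappa -!EFinM; congr EFin.
  have -> : G (r ^+ 2) = g (r ^+ 2) by rewrite /G patchE mem_setE in_itv/= sqr_ge0.
  move: (besselker _ _ _) (_ `^ nu) (g _) => k v gr.
  have : 0 < pi `^ (n%:R / 2) :> R by rewrite powR_gt0// pi_gt0.
  by move: (pi `^ _) => p p0; field; exact: lt0r_neq0.
rewrite /ell_phi_rhs /Rintegral FE integralZl//; last first.
  apply: integrable_sqr => //; exact: (integrableS measurableT).
rewrite -integral_sqr// -qE fineM//; last exact: integrable_fin_num.
have kE : (2 * pi) `^ (n%:R / 2) * u `^ (- nu) * kappa = 1.
  have p0 : 0 < pi `^ (n%:R / 2) :> R by rewrite powR_gt0// pi_gt0.
  have u0' : 0 < u `^ nu by rewrite powR_gt0.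
  have v0 : 0 < 2 `^ nu :> R by rewrite powR_gt0.
  have h2 : 2 `^ (n%:R / 2) = 2 `^ nu * 2 :> R.
    rewrite (_ : n%:R / 2 = nu + 1); last by rewrite /nu; field.
    by rewrite powRD ?(gt_eqF (ltr0Sn _ 1)) ?implybT// powRr1.
  rewrite /kappa powRM ?pi_ge0// powRN h2.
  have -> : (u / 2) `^ nu = u `^ nu / 2 `^ nu.
    rewrite powRM ?invr_ge0 ?(ltW u0)//; congr (_ * _).
    apply: (mulIf (lt0r_neq0 v0)); rewrite mulVf ?lt0r_neq0//.
    by rewrite -powRM ?invr_ge0// mulVf ?powR1// pnatr_eq0.
  by move: (pi `^ _) (u `^ nu) (2 `^ nu) p0 u0' v0 => x y z x0 y0 z0; field;
    rewrite !lt0r_neq0.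
rewrite -[fine (\int[leb]_s q s)]/(bessel_mean n G b) -[fine _]/kappa -/nu.
move: (ell_const n g) (bessel_mean n G b) kappa kE {FE} => c m kappa.
move: ((2 * pi) `^ _) (u `^ - nu) => x y kE.
by rewrite -[RHS]mulr1 -kE; ring.
Qed.

End bessel_transform.

(** * Elliptical random vectors *)

Section elliptical.
Context {R : realType} {d : measure_display} {T : measurableType d}.
Variables (P : probability T R) (n : nat) (g : R -> R).
Variable Z : {RV P >-> n.+1.-tuple R}.
Hypothesis hZ : ell_std g Z.
Local Notation leb := (@lebesgue_measure R).

Let G : R -> R := g \_ (`[0, +oo[ : set R).
Let c : R := ell_const n.+1 g.
Let cG (s : R) := c * G s.

Let mG : measurable_fun setT G.
Proof.
have [[mg _ _] _] := hZ.
by apply/(measurable_restrictT _ _).1.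
Qed.

Let G0 s : 0 <= G s.
Proof.
have [[_ g0 _] _] := hZ.
by rewrite /G patchE mem_setE in_itv/= andbT; case: ifP => // /g0.
Qed.

Let c0 : 0 <= c.
Proof.
rewrite mulr_ge0 ?divr_ge0 ?Gamma_ge0 ?powR_ge0// invr_ge0 Rintegral_ge0// => z.
rewrite /= in_itv/= andbT => z0; have [[_ g0 _] _] := hZ.
by rewrite mulr_ge0 ?powR_ge0// g0.
Qed.

Let mcG : measurable_fun setT cG.
Proof. exact: measurable_funM. Qed.

Let cG0 s : 0 <= cG s.
Proof. exact: mulr_ge0. Qed.

Lemma integral_ell (A B theta : R) (w : 'cV[R]_n.+1) : `|B| <= A ->
  (\int[P]_x (A + B * cos (theta + dotv w (colv (Z x))))%:E =
   \int[leb]_s (cG s * radial_dens n.+1 A B theta (dotv w w) s)%:E)%E.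
Proof.
move=> BA.
pose f (z : n.+1.-tuple R) := (A + B * cos (theta + dotv w (colv z)))%:E.
pose rho (z : n.+1.-tuple R) := cG (dotv (colv z) (colv z)).
have mrho : measurable_fun setT rho.
  by apply: (measurableT_comp mcG); exact: measurable_sqr_dotv.
have rho0 z : 0 <= rho z by exact: cG0.
have mf : measurable_fun setT f.
  have := @measurable_radial_wave R n.+1 (cst 1) A B theta w (measurable_cst _).
  rewrite /radial_wave/=; under eq_fun do rewrite mul1r.
  by move=> h; apply/measurable_EFinP.
have f0 z : (0 <= f z)%E.
  have := @radial_wave_ge0 R n.+1 (cst 1) A B theta w z (fun=> ler01) BA.
  by rewrite /radial_wave/= mul1r /f lee_fin.
rewrite -integral_radial_wave//.
transitivity (\int[distribution P Z]_z f z)%E.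
  by rewrite ge0_integral_distribution.
transitivity (\int[with_density (lebesgue_tuple R n.+1) rho]_z f z)%E.
  apply: eq_measure_integral => S mS _; have [_ hd] := hZ.
  apply: (etrans (hd S mS)).
  apply: eq_integral => z _; rewrite /rho /cG /c /G patchE mem_setE in_itv/= andbT.
  by rewrite dotv_ge0.
rewrite ge0_integral_with_density//.
by apply: eq_integral => z _; rewrite -EFinM mulrC.
Qed.

(** The case B = 0 of the previous formula, since the law of Z has mass 1. *)
Let mean0 : (\int[leb]_s (cG s * sphker n.+1 0 s)%:E = 1)%E.
Proof.
have := @integral_ell 1 0 0 0 _; rewrite normr0 => /(_ ler01).
under eq_integral do rewrite mul0r addr0.
rewrite integral_cst// [X in (_ * X)%E](_ : _ = 1%E); last exact: probability_setT.
rewrite mul1e => ->.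
by apply: eq_integral => s _; rewrite /radial_dens mul1r !mul0r addr0.
Qed.

Let int0 : leb.-integrable setT (fun s => (cG s * sphker n.+1 0 s)%:E).
Proof.
apply/integrableP; split.
  by apply/measurable_EFinP; apply: measurable_funM => //; exact: measurable_sphker.
rewrite (_ : (\int[_]_x _)%E = 1%E) ?ltry// -mean0.
apply: eq_integral => s _; rewrite gee0_abs// lee_fin.
by apply: mulr_ge0; [exact: cG0|exact: sphker0_ge0].
Qed.

Let bmean (b : R) : R := bessel_mean n.+1 cG b.

Lemma ell_cos (theta : R) (w : 'cV[R]_n.+1) :
  (\int[P]_x (1 + cos (theta + dotv w (colv (Z x))))%:E =
   (1 + cos theta * bmean (dotv w w))%:E)%E.
Proof.
have iw := integrable_sphker (ltn0Sn n) (dotv_ge0 w) mcG cG0 int0.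
have := @integral_ell 1 1 theta w _; rewrite normr1 => /(_ (lexx _)).
under eq_integral do rewrite mul1r.
move=> ->.
transitivity (\int[leb]_s ((cG s * sphker n.+1 0 s)%:E +
    (cos theta)%:E * (cG s * sphker n.+1 (dotv w w) s)%:E))%E.
  apply: eq_integral => s _; rewrite /radial_dens -EFinM -EFinD; congr EFin.
  by move: (sphker n.+1 0 s) (sphker n.+1 (dotv w w) s) => a b; ring.
rewrite integralD//; last exact: integrableZl.
rewrite mean0 integralZl// EFinD EFinM; congr (_ + _ * _)%E.
by rewrite /bmean /bessel_mean /Rintegral fineK// integrable_fin_num.
Qed.

Lemma bmean0 : bmean 0 = 1.
Proof. by rewrite /bmean /bessel_mean /Rintegral mean0. Qed.

Let w1 (u : R) : 'cV[R]_n.+1 := \col_i (u *+ (i == ord0)).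

Let dotv_w1 u z : dotv (w1 u) z = u * z ord0 0.
Proof.
rewrite dotvE big_ord_recl !mxE eqxx mulr1n big1 ?addr0// => i _.
by rewrite !mxE mul0r.
Qed.

Let dotv_w11 u : dotv (w1 u) (w1 u) = u ^+ 2.
Proof. by rewrite dotv_w1 mxE eqxx. Qed.

(** 1 + cos is nonnegative, at the phases 0 and pi. *)
Lemma normr_bmean_le1 (b : R) : 0 <= b -> `|bmean b| <= 1.
Proof.
move=> b0.
have H theta : 0 <= 1 + cos theta * bmean b.
  rewrite -(sqr_sqrtr b0) -dotv_w11 -lee_fin -ell_cos.
  by apply: integral_ge0 => x _; rewrite lee_fin -lerBlDl sub0r cos_geN1.
have := H 0; have := H pi; rewrite cospi cos0 mulN1r mul1r ler_norml => h1 h2.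
by apply/andP; split; [rewrite -lerBlDl sub0r in h2|rewrite -subr_ge0].
Qed.

(** The integrals of cos (u z_1) tend to 1 by dominated convergence. *)
Lemma cvg_bmean : bmean (u ^+ 2) @[u --> 0^'+] --> (1 : R).
Proof.
apply/cvg_at_rightP => u [u0 cu].
pose f_ k (x : T) := (1 + cos (0 + dotv (w1 (u k)) (colv (Z x))))%:E.
have fE k : (\int[P]_x f_ k x)%E = (1 + bmean (u k ^+ 2))%:E.
  by rewrite ell_cos cos0 mul1r dotv_w11.
have mcos w : measurable_fun setT (fun x => (1 + cos (0 + dotv w (colv (Z x))))%:E).
  apply/measurable_EFinP; apply: measurable_funD => //.
  apply: measurableT_comp.
    by apply: continuous_measurable_fun; exact: continuous_cos.
  apply: measurable_funD => //.
  exact: (measurableT_comp (measurable_dotv w)).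
have cf : {ae P, forall x, setT x -> f_ ^~ x @ \oo --> (cst (2 : R)%:E x : \bar R)}.
  apply: aeW => x _; apply: cvg_EFin; first exact: nearW.
  have -> : (2 : R) = 1 + cos 0 by rewrite cos0.
  apply: cvgD; first exact: cvg_cst.
  have h : 0 + dotv (w1 (u k)) (colv (Z x)) @[k --> \oo] --> (0 : R).
    under eq_fun do rewrite add0r dotv_w1.
    by rewrite -(mul0r (colv (Z x) ord0 0)); apply: cvgM => //; exact: cvg_cst.
  exact: (cvg_comp _ _ h (@continuous_cos R 0)).
have fg : {ae P, forall x k, setT x -> (`|f_ k x| <= cst (2 : R)%:E x)%E}.
  apply: aeW => x k _; rewrite /f_ lee_fin ger0_norm.
    by rewrite (_ : 2 = 1 + 1) ?lerD2l ?cos_le1.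
  by rewrite -lerBlDl sub0r cos_geN1.
have i2 : P.-integrable setT (cst (2 : R)%:E).
  exact: (finite_measure_integrable_cst P 2).
have [_ _] := @dominated_convergence _ T R P setT measurableT f_
  (cst (2 : R)%:E) (cst (2 : R)%:E) (fun k => mcos (w1 (u k)))
  (measurable_cst _) cf i2 fg.
rewrite integral_cst// [X in (_ * X)%E](_ : _ = 1%E); last exact: probability_setT.
rewrite mule1.
under eq_fun do rewrite fE.
move=> /fine_cvgP[_ h].
have h1 : (fun=> 1 : R) @ \oo --> (1 : R) by exact: cvg_cst.
have <- : 2 - 1 = 1 :> R by ring.
apply: cvg_trans (cvgB h h1); apply: near_eq_cvg; apply: nearW => k /=.
by rewrite addrC addKr.
Qed.

Let c_neq0 : c != 0.
Proof.
apply/eqP => cz; have := mean0; rewrite integral0_eq.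
  by move/eqP; rewrite lt_eqF// lte_fin.
by move=> s _; rewrite /cG cz !mul0r.
Qed.

Let ell_phi_rhs_bmean (u : R) : 0 < u -> ell_phi_rhs n.+1 g u = bmean (u ^+ 2).
Proof.
move=> u0.
have iG0 : leb.-integrable setT (fun s => (G s * sphker n.+1 0 s)%:E).
  have := integrableZl measurableT c^-1 int0; apply: eq_integrable => // s _.
  by rewrite -EFinM /cG -(mulrA c) mulKf.
rewrite ell_phi_rhsE// -/G -/c.
have iGu := integrable_sphker (ltn0Sn n) (sqr_ge0 u) mG G0 iG0.
rewrite /bmean /bessel_mean -RintegralZl//.
by apply: eq_Rintegral => s _; rewrite mulrA.
Qed.

Lemma ell_phiE (s : R) : 0 <= s -> ell_phi n.+1 g s = bmean s.
Proof.
rewrite /ell_phi le_eqVlt eq_sym => /predU1P[->|s0].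
  rewrite eqxx bmean0; apply/cvg_lim => //.
  apply: cvg_trans cvg_bmean; apply: near_eq_cvg; near=> u.
  by rewrite ell_phi_rhs_bmean.
rewrite (gt_eqF s0) ell_phi_rhs_bmean; last by rewrite sqrtr_gt0.
by rewrite sqr_sqrtr// ltW.
Unshelve. all: by end_near. Qed.

(** The characteristic function of Z, with an arbitrary phase; theta = 0 and
    theta = - pi / 2 are its real and imaginary parts. *)
Lemma ell_std_cos (theta : R) (w : 'cV[R]_n.+1) :
  (\int[P]_x (1 + cos (theta + dotv w (colv (Z x))))%:E =
   (1 + cos theta * ell_phi n.+1 g (dotv w w))%:E)%E.
Proof. by rewrite ell_cos ell_phiE// dotv_ge0. Qed.

Lemma normr_ell_phi_le1 (s : R) : 0 <= s -> `|ell_phi n.+1 g s| <= 1.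
Proof. by move=> s0; rewrite ell_phiE// normr_bmean_le1. Qed.

End elliptical.

(** * Variance-mean mixtures *)

Section mixture.
Context {R : realType} {d : measure_display} {T : measurableType d}.
Variable P : probability T R.

(** Independence means that the joint law is the product of the laws. *)
Lemma ge0_integral_independent (d1 d2 : measure_display)
    (T1 : measurableType d1) (T2 : measurableType d2)
    (X : {RV P >-> T1}) (Y : {RV P >-> T2}) (f : T1 -> T2 -> \bar R) :
  independent_rv X Y -> measurable_fun setT (fun z => f z.1 z.2) ->
  (forall x y, 0 <= f x y)%E ->
  (\int[P]_w f (X w) (Y w) =
   \int[distribution P Y]_y \int[P]_w f (X w) y)%E.
Proof.
move=> XY mf f0.
have mXY : measurable_fun setT (fun w => (X w, Y w)).
  by apply: measurable_fun_pair.
have PXY A : measurable A ->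
    pushforward P (fun w => (X w, Y w)) A = (distribution P X \x distribution P Y)%E A.
  move=> mA; apply/esym.
  apply: (@product_measure_unique _ _ _ _ _ (distribution P X) (distribution P Y)
    (measure_function_pushforward__canonical__measure_function_Measure P mXY)) => //.
transitivity (\int[pushforward P (fun w => (X w, Y w))]_z f z.1 z.2)%E.
  by rewrite ge0_integral_pushforward.
transitivity (\int[distribution P X \x distribution P Y]_z f z.1 z.2)%E.
  by apply: eq_measure_integral => A mA _; exact: PXY.
rewrite fubini_tonelli2//; apply: eq_integral => y _.
rewrite /fubini_G/= ge0_integral_distribution//.
exact: (measurableT_comp mf (measurable_pair2 y)).
Qed.

Variables (n : nat) (g : R -> R).
Variables (Z : {RV P >-> n.+1.-tuple R}) (V : {RV P >-> R}).
Hypotheses (hZ : ell_std g Z) (hV : forall w, 0 <= V w).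
Hypothesis hZV : independent_rv Z V.
Local Notation F := (distribution P V).
Local Notation phi := (ell_phi n.+1 g).

Let mcos : measurable_fun setT (@cos R).
Proof. by apply: continuous_measurable_fun; exact: continuous_cos. Qed.

Let dotvZZ k (a : 'cV[R]_n.+1) : dotv (k *: a) (k *: a) = k ^+ 2 * dotv a a.
Proof.
rewrite !dotvE mulr_sumr; apply: eq_bigr => i _.
by rewrite !mxE mulrACA expr2.
Qed.

Let dotvZ k (a b : 'cV[R]_n.+1) : dotv (k *: a) b = k * dotv a b.
Proof.
rewrite !dotvE mulr_sumr; apply: eq_bigr => i _.
by rewrite !mxE mulrA.
Qed.

Let wave (theta alpha : R) (a : 'cV[R]_n.+1) (z : n.+1.-tuple R) (v : R) : R :=
  1 + cos ((theta + v * alpha) + Num.sqrt v * dotv a (colv z)).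

Let wave_ge0 theta alpha a z v : 0 <= wave theta alpha a z v.
Proof. by rewrite -lerBlDl sub0r cos_geN1. Qed.

Let measurable_wave theta alpha a :
  measurable_fun setT (fun p => wave theta alpha a p.1 p.2).
Proof.
apply: measurable_funD => //; apply: measurableT_comp => //.
apply: measurable_funD.
  by apply: measurable_funD => //; exact: measurable_funM.
apply: measurable_funM.
  apply: measurableT_comp => //; apply: continuous_measurable_fun.
  exact: sqrt_continuous.
exact: (measurableT_comp (measurable_dotv a)).
Qed.

Let integral_wave theta alpha a v :
  (\int[P]_x (wave theta alpha a (Z x) v)%:E =
   (1 + cos (theta + v * alpha) * phi (Num.sqrt v ^+ 2 * dotv a a))%:E)%E.
Proof.
rewrite -dotvZZ -(ell_std_cos hZ); apply: eq_integral => x _.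
by rewrite /wave dotvZ.
Qed.

Let integral_law_ge0 (f : R -> \bar R) : measurable_fun setT f -> (forall v, 0 <= f v)%E ->
  (\int[F]_v f v = \int[F]_(v in `[0%R, +oo[) f v)%E.
Proof.
move=> mf f0; rewrite [RHS]integral_mkcond !ge0_integral_distribution//.
- by apply: eq_integral => w _ /=; rewrite patchE mem_setE in_itv/= hV.
- by apply/(measurable_restrictT _ _).1 => //; exact: measurable_funTS.
- by move=> v; rewrite patchE; case: ifP.
Qed.

Let measurable_integral_wave theta alpha a :
  measurable_fun setT (fun v => \int[P]_x (wave theta alpha a (Z x) v)%:E)%E.
Proof.
have : measurable_fun setT
    (fun v : R => \int[distribution P Z]_z (wave theta alpha a z v)%:E)%E.
  apply: (@measurable_fun_fubini_tonelli_G _ _ _ _ R (distribution P Z)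
    (fun p => (wave theta alpha a p.1 p.2)%:E)).
  - by apply/measurable_EFinP; exact: measurable_wave.
  - by move=> p; rewrite lee_fin.
apply: eq_measurable_fun => v _.
rewrite ge0_integral_distribution//; last by move=> z; rewrite lee_fin.
apply/measurable_EFinP.
exact: (measurableT_comp (measurable_wave theta alpha a) (measurable_pair2 v)).
Qed.

Let measurable_phi (a : 'cV[R]_n.+1) :
  measurable_fun (`[0, +oo[ : set R) (fun v => phi (v * dotv a a)).
Proof.
have m2 : measurable_fun setT (fun v : R => phi (Num.sqrt v ^+ 2 * dotv a a)).
  have : measurable_fun setT (fun v : R =>
      fine (\int[P]_x (wave 0 0 a (Z x) v)%:E)%E - 1).
    apply: measurable_funB => //.
    exact: (measurableT_comp (fine_measurable measurableT)
      (measurable_integral_wave 0 0 a)).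
  apply: eq_measurable_fun => v _.
  by rewrite /= integral_wave mulr0 addr0 cos0 mul1r addrC addKr.
apply: eq_measurable_fun (measurable_funTS m2) => v.
by rewrite inE/= in_itv/= andbT => v0; rewrite sqr_sqrtr.
Qed.

Lemma integrable_cos_phi (theta alpha : R) (a : 'cV[R]_n.+1) :
  F.-integrable `[0, +oo[ (fun v =>
    (cos (theta + v * alpha) * phi (v * dotv a a))%:E).
Proof.
apply: (@le_integrable _ _ _ _ _ _ _ (cst 1%E)) => //.
- apply/measurable_EFinP; apply: measurable_funM; last exact: measurable_phi.
  apply: measurable_funTS; apply: measurableT_comp => //.
  by apply: measurable_funD => //; exact: measurable_funM.
- move=> v; rewrite /= in_itv/= andbT => v0; rewrite lee_fin normr1 normrM.
  rewrite -[leRHS]mulr1; apply: ler_pM => //; first exact: normr_cos_le1.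
  by apply: (normr_ell_phi_le1 hZ); rewrite mulr_ge0// dotv_ge0.
- exact: (finite_measure_integrable_cst F 1).
Qed.

(** Conditioning on V = v leaves the characteristic function of Z at
    sqrt v a; adding 1 to the cosine keeps everything nonnegative, as needed
    for Tonelli. *)
Lemma mixture_cos (theta alpha : R) (a : 'cV[R]_n.+1) :
  \int[P]_x cos (theta + V x * alpha + Num.sqrt (V x) * dotv a (colv (Z x))) =
  \int[F]_(v in `[0, +oo[) (cos (theta + v * alpha) * phi (v * dotv a a)).
Proof.
pose X x := cos (theta + V x * alpha + Num.sqrt (V x) * dotv a (colv (Z x))).
have mX : measurable_fun setT X.
  have mZV : measurable_fun setT (fun x => (Z x, V x)) by exact: measurable_fun_pair.
  have mw : measurable_fun setT (fun x => wave theta alpha a (Z x) (V x) - 1).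
    apply: measurable_funB => //.
    exact: (measurableT_comp (measurable_wave theta alpha a) mZV).
  apply: eq_measurable_fun mw => x _.
  by rewrite /= /wave addrC addKr.
have iX : P.-integrable setT (EFin \o X).
  apply: (@le_integrable _ _ _ _ _ _ _ (cst 1%E)) => //.
  - exact/measurable_EFinP.
  - by move=> x _; rewrite /= lee_fin normr1 normr_cos_le1.
  - exact: (finite_measure_integrable_cst P 1).
have i1 : P.-integrable setT (EFin \o cst 1) :=
  finite_measure_integrable_cst P 1 measurableT.
have iF := integrable_cos_phi theta alpha a.
have F1 : (F `[0%R, +oo[ = 1)%E.
  have := integral_law_ge0 (measurable_cst 1%E) (fun=> lee01).
  by rewrite !integral_cst// !mul1e => <-; exact: probability_setT.
have E : (1 + \int[P]_x (X x)%:E = 1 + \int[F]_(v in `[0%R, +oo[)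
    (cos (theta + v * alpha) * phi (v * dotv a a))%:E)%E.
  transitivity (\int[P]_x (wave theta alpha a (Z x) (V x))%:E)%E.
    under [RHS]eq_integral do rewrite EFinD.
    rewrite integralD// integral_cst// [X in (_ * X)%E](_ : _ = 1%E) ?mul1e//.
    exact: probability_setT.
  rewrite (@ge0_integral_independent _ _ _ _ _ _
    (fun z v => (wave theta alpha a z v)%:E) hZV)//; last 2 first.
  - by apply/measurable_EFinP; exact: measurable_wave.
  - by move=> z v; rewrite lee_fin.
  rewrite integral_law_ge0; last 2 first.
  - exact: measurable_integral_wave.
  - by move=> v; apply: integral_ge0 => x _; rewrite lee_fin.
  under [LHS]eq_integral => v.
    rewrite inE/= in_itv/= andbT => v0.
    rewrite integral_wave sqr_sqrtr// EFinD.
    over.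
  rewrite integralD//; last first.
    exact: (integrableS measurableT _ _ (finite_measure_integrable_cst F 1 measurableT)).
  by rewrite integral_cst// [X in (X + _ = _)%E](_ : _ = 1%E)// mul1e; exact: F1.
have fX := integrable_fin_num measurableT iX.
have fF := integrable_fin_num (measurable_itv _) iF.
by move: E; rewrite -(fineK fX) -(fineK fF) -!EFinD => -[/addrI].
Qed.

End mixture.

Section dotv_linear.
Variables (R : realType) (n : nat).
Implicit Types (t u v : 'cV[R]_n) (S : 'M[R]_n).

Lemma dotvDr t u v : dotv t (u + v) = dotv t u + dotv t v.
Proof. by rewrite /dotv mulmxDr mxE. Qed.

Lemma dotvZr t k u : dotv t (k *: u) = k * dotv t u.
Proof. by rewrite /dotv -scalemxAr mxE. Qed.

Lemma dotv_mulmx t S u : dotv t (S *m u) = dotv (S^T *m t) u.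
Proof. by rewrite /dotv trmx_mul trmxK mulmxA. Qed.

End dotv_linear.

Local Open Scope complex_scope.

Theorem theorem4p1 (R : realType) (d : measure_display) (T : measurableType d)
  (P : probability T R) (n : nat) (hn : (1 <= n)%N)
  (mu gamma : 'cV[R]_n) (Sigma Sigma12 : 'M[R]_n)
  (hSigma : posdefmx Sigma) (hSigma12 : is_sqrtmx Sigma Sigma12)
  (g : R -> R) (Z : {RV P >-> n.-tuple R}) (hZ : ell_std g Z)
  (V : {RV P >-> R}) (hV : forall w, 0 <= V w)
  (hZV : independent_rv Z V)
  (X : T -> 'cV[R]_n)
  (hX : forall w, X w = mu + V w *: gamma
                        + Num.sqrt (V w) *: (Sigma12 *m colv (Z w))) :
  forall t : 'cV[R]_n,
    charfun P X t =
    cexpi (dotv t mu) *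
    Cintegral (distribution P V) `[0, +oo[
      (fun v => cexpi (v * dotv t gamma) *
                (ell_phi n g (v * quadf Sigma t))%:C).
Proof.
move=> t; case: n hn mu gamma Sigma Sigma12 hSigma hSigma12 Z hZ hZV X hX t => // n _.
move=> mu gamma Sigma S _ [[S_sym _] SS] Z hZ hZV X hX t.
set th := dotv t mu; set al := dotv t gamma.
set a := S^T *m t.
have aE : dotv a a = quadf Sigma t.
  by rewrite /dotv /quadf /a -SS S_sym trmx_mul S_sym !mulmxA.
have tX w : dotv t (X w) = th + V w * al + Num.sqrt (V w) * dotv a (colv (Z w)).
  by rewrite hX !dotvDr !dotvZr dotv_mulmx.
pose phi v := ell_phi n.+1 g (v * quadf Sigma t).
have mix theta : \int[P]_w cos (theta + (V w * al + Num.sqrt (V w) * dotv a (colv (Z w)))) =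
    \int[distribution P V]_(v in `[0, +oo[) (cos (theta + v * al) * phi v).
  rewrite /phi -aE -(mixture_cos hZ hV hZV).
  by apply: eq_Rintegral => w _; rewrite addrA.
have sinE x : sin x = cos (- (pi / 2) + x) :> R by rewrite addrC cosBpihalf.
have icos : (distribution P V).-integrable `[0, +oo[ (EFin \o (fun v => cos (v * al) * phi v)).
  have := integrable_cos_phi V hZ 0 al a; rewrite aE.
  by apply: eq_integrable => // v _; rewrite add0r.
have isin : (distribution P V).-integrable `[0, +oo[ (EFin \o (fun v => sin (v * al) * phi v)).
  have := integrable_cos_phi V hZ (- (pi / 2)) al a; rewrite aE.
  by apply: eq_integrable => // v _; rewrite -sinE.
have mI : measurable (`[0, +oo[ : set R) by [].
have iZ k (f : R -> R) : (distribution P V).-integrable `[0, +oo[ (EFin \o f) ->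
    (distribution P V).-integrable `[0, +oo[ (EFin \o (fun v => k * f v)).
  by move=> fi; have := integrableZl mI k fi; apply: eq_integrable => // v _; rewrite /= EFinM.
have ReE : \int[distribution P V]_(v in `[0, +oo[)
    complex.Re (cexpi (v * al) * (phi v)%:C) =
    \int[distribution P V]_(v in `[0, +oo[) (cos (v * al) * phi v).
  by apply: eq_Rintegral => v _ /=; rewrite mulr0 subr0.
have ImE : \int[distribution P V]_(v in `[0, +oo[)
    complex.Im (cexpi (v * al) * (phi v)%:C) =
    \int[distribution P V]_(v in `[0, +oo[) (sin (v * al) * phi v).
  by apply: eq_Rintegral => v _ /=; rewrite mulr0 add0r.
rewrite /charfun /Cintegral ReE ImE /cexpi.
apply/eqP; rewrite eq_complex /=; apply/andP; split; apply/eqP.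
  transitivity (\int[P]_w cos (th + (V w * al + Num.sqrt (V w) * dotv a (colv (Z w))))).
    by apply: eq_Rintegral => w _; rewrite tX addrA.
  rewrite mix -!RintegralZl// -RintegralB//; [|exact: iZ|exact: iZ].
  by apply: eq_Rintegral => v _; rewrite cosD mulrBl !mulrA.
transitivity (\int[P]_w cos ((- (pi / 2) + th) +
    (V w * al + Num.sqrt (V w) * dotv a (colv (Z w))))).
  by apply: eq_Rintegral => w _; rewrite tX sinE !addrA.
rewrite mix -!RintegralZl// -RintegralD//; [|exact: iZ|exact: iZ].
apply: eq_Rintegral => v _; rewrite -addrA -sinE sinD; ring.
Qed.
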